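(* If an arbitrary Markov chain on a measurable space $(X,\Sigma)$ satisfies $\Delta_{ba}\subset ca(X,\Sigma)$, then the chain is quasicompact, i.e. there exist a compact operator $A_1:ca(X,\Sigma)\to ca(X,\Sigma)$ and an integer $k\ge 1$ such that $\|A^k-A_1\|<1$, where $A$ is considered as an operator on $ca(X,\Sigma)$.
   Context: $X$ is an arbitrary infinite set and $\Sigma$ is a $\sigma$-algebra of subsets of $X$ containing all singletons. $B(X,\Sigma)$ is the Banach space of bounded $\Sigma$-measurable functions $f:X\to\mathbb{R}$ with the sup-norm. $ba(X,\Sigma)$ is the Banach space of bounded finitely additive measures $\mu:\Sigma\to\mathbb{R}$ with the total variation norm, and $ca(X,\Sigma)$ is its subspace of countably additive measures. $S_{ba}=\{\mu\in ba(X,\Sigma):\mu\ge 0,\ \|\mu\|=1\}$. A Markov chain is given by a transition function $p(x,E)$, $x\in X$, $E\in\Sigma$, with $0\le p(x,E)\le 1$, $p(x,X)=1$, $p(\cdot,E)\in B(X,\Sigma)$ for all $E\in\Sigma$, and $p(x,\cdot)\in ca(X,\Sigma)$ for all $x\in X$. The Markov operator $A:ba(X,\Sigma)\to ba(X,\Sigma)$ is $A\mu(E)=\int_X p(x,E)\,\mu(dx)$; it maps $ca(X,\Sigma)$ into itself. $\Delta_{ba}=\{\mu\in S_{ba}: A\mu=\mu\}$. *)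

(* Defs.v *)
From HB Require Import structures.
From mathcomp Require Import all_boot all_order all_algebra.
From mathcomp Require Import finmap.
From mathcomp Require Import all_classical all_reals all_analysis.
From mathcomp Require Import measurable_realfun.
From mathcomp Require Import zify lra.

Set Implicit Arguments.
Unset Strict Implicit.
Unset Printing Implicit Defensive.

Import Order.TTheory GRing.Theory Num.Theory.
Import numFieldTopology.Exports numFieldNormedType.Exports.

Local Open Scope classical_set_scope.
Local Open Scope ring_scope.

Section ba.
Context {d : measure_display} (X : measurableType d) (R : realType).
Implicit Types (E F : set X).

(* Elements of ba(X, Sigma) are functions on Sigma; they are represented here as
   functions on all subsets of X that vanish outside Sigma, so that Leibniz
   equality is equality on Sigma. *)
Definition is_ba : set (set X -> R) := [set mu |
  [/\ forall E, ~ measurable E -> mu E = 0,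
      forall E F, measurable E -> measurable F -> E `&` F = set0 ->
        mu (E `|` F) = mu E + mu F
    & exists M : R, forall E, measurable E -> `|mu E| <= M]].

(* The supremum of these sums over finite disjoint families of measurable sets is
   the total variation of mu on X. *)
Definition variation_sums (mu : set X -> R) : set R := [set r |
  exists (n : nat) (F : (set X)^nat),
    [/\ forall i, measurable (F i), trivIset `I_n F
      & r = \sum_(i < n) `|mu (F i)|]].

Definition ba_variation (mu : set X -> R) : R := sup (variation_sums mu).

Definition ba_pred : {pred (set X -> R)} := fun mu => mu \in is_ba.

Lemma ba_submod_closed : submod_closed ba_pred.
Proof.
split=> [|a mu nu].
  rewrite inE; split=> // [E F _ _ _|]; first by rewrite addr0.
  by exists 0 => E _; rewrite normr0.
have linE E : (a *: mu + nu) E = a * mu E + nu E by [].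
rewrite !inE => -[mu0 muD [M muM]] [nu0 nuD [N nuN]]; split.
- by move=> E nE; rewrite linE mu0 // nu0 // mulr0 addr0.
- by move=> E F mE mF EF; rewrite !linE muD // nuD // mulrDr addrACA.
- exists (`|a| * M + N) => E mE; rewrite linE.
  rewrite (le_trans (ler_normD _ _)) // lerD ?nuN //.
  by rewrite normrM ler_wpM2l // muM.
Qed.

HB.instance Definition _ :=
  GRing.isSubmodClosed.Build R (set X -> R) ba_pred ba_submod_closed.

Record ba := Ba { ba_val :> set X -> R; _ : ba_val \in ba_pred }.

HB.instance Definition _ := [isSub for ba_val].
HB.instance Definition _ := [Choice of ba by <:].
HB.instance Definition _ := [SubChoice_isSubLmodule of ba by <:].

Lemma ba_nmeas (mu : ba) E : ~ measurable E -> mu E = 0.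
Proof. by case: mu => mu /=; rewrite inE => -[+ _ _]; exact. Qed.

Lemma ba_add (mu : ba) E F : measurable E -> measurable F -> E `&` F = set0 ->
  mu (E `|` F) = mu E + mu F.
Proof. by case: mu => mu /=; rewrite inE => -[_ + _]; exact. Qed.

Lemma ba_bounded (mu : ba) : exists M : R, forall E, measurable E -> `|mu E| <= M.
Proof. by case: mu => mu /=; rewrite inE => -[_ _ +]. Qed.

Lemma ba_set0 (mu : ba) : mu set0 = 0.
Proof.
have := @ba_add mu set0 set0 measurable0 measurable0 (setI0 _).
by rewrite setU0 => /eqP; rewrite eq_sym -subr_eq0 addrK => /eqP.
Qed.

Lemma ba_bigU (mu : ba) (T : choiceType) (s : seq T) (Q : pred T)
    (E : T -> set X) : uniq s -> (forall t, measurable (E t)) ->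
    trivIset [set` s] E ->
  mu (\big[setU/set0]_(t <- s | Q t) E t) = \sum_(t <- s | Q t) mu (E t).
Proof.
move=> + mE; elim: s => [|t s ih] /=; first by rewrite !big_nil ba_set0.
move=> /andP[ts us] tE.
have {}ih : mu (\big[setU/set0]_(t <- s | Q t) E t) = \sum_(t <- s | Q t) mu (E t).
  by apply: ih => //; apply: sub_trivIset tE => x /= xs; rewrite inE xs orbT.
rewrite !big_cons; case: ifP => // Qt; rewrite ba_add ?ih //.
  by apply: bigsetU_measurable.
rewrite -subset0 => x [Etx]; rewrite -bigcup_seq_cond => -[u /= /andP[us' _] Eux].
have /= tu := tE t u; move: ts; rewrite tu ?us' // ?inE ?eqxx ?us' ?orbT //.
by exists x.
Qed.

Lemma variation_sums_ub (mu : ba) : has_ubound (variation_sums mu).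
Proof.
have [M muM] := ba_bounded mu.
exists (M + M) => _ [n [F [mF tF ->]]].
pose P (i : nat) := 0 <= mu (F i).
have uF : uniq (index_iota 0 n) by exact: iota_uniq.
have tF' : trivIset [set` index_iota 0 n] F.
  by apply: sub_trivIset tF => i /=; rewrite mem_index_iota.
rewrite -(big_mkord xpredT (fun i => `|mu (F i)|)) (bigID P) /=; apply: lerD.
  rewrite (eq_bigr (fun i => mu (F i))) => [|i Pi]; last by rewrite ger0_norm.
  rewrite -ba_bigU // (le_trans (ler_norm _)) // muM //.
  exact: bigsetU_measurable.
rewrite (eq_bigr (fun i => - mu (F i))) => [|i Pi]; last first.
  by rewrite ltr0_norm // ltNge.
rewrite sumrN -ba_bigU // (le_trans (ler_norm _)) // normrN muM //.
exact: bigsetU_measurable.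
Qed.

Lemma variation_sums_neq0 (mu : set X -> R) : variation_sums mu !=set0.
Proof.
by exists 0, 0%N, (fun=> set0); split=> //; rewrite ?big_ord0 // => ? [].
Qed.

Definition ba_norm (mu : ba) : R := ba_variation mu.

Lemma le_variation (mu : ba) n (F : (set X)^nat) :
    (forall i, measurable (F i)) -> trivIset `I_n F ->
  \sum_(i < n) `|mu (F i)| <= ba_norm mu.
Proof.
by move=> mF tF; apply: (ub_le_sup (variation_sums_ub mu)); exists n, F.
Qed.

Lemma variation_le (mu : ba) (M : R) :
  (forall n (F : (set X)^nat), (forall i, measurable (F i)) -> trivIset `I_n F ->
    \sum_(i < n) `|mu (F i)| <= M) -> ba_norm mu <= M.
Proof.
move=> muM; apply: (ge_sup (variation_sums_neq0 mu)).
by move=> _ [n [F [mF tF ->]]]; exact: muM.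
Qed.

Lemma le_norm_variation (mu : ba) E : `|mu E| <= ba_norm mu.
Proof.
have [mE|nE] := pselect (measurable E); last first.
  rewrite ba_nmeas // normr0; have := @le_variation mu 0 (fun=> set0).
  by rewrite big_ord0; apply=> // i j [].
have := @le_variation mu 1 (fun=> E); rewrite big_ord1; apply=> //.
by move=> [|i] [|j] //= _ _ _.
Qed.

Lemma ba_normD (mu nu : ba) :
  ba_norm (mu + nu) <= ba_norm mu + ba_norm nu.
Proof.
apply: variation_le => n F mF tF.
apply: le_trans (lerD (le_variation mu mF tF) (le_variation nu mF tF)).
by rewrite -big_split; apply: ler_sum => i _; exact: ler_normD.
Qed.

Lemma ba_norm_ge0 (mu : ba) : 0 <= ba_norm mu.
Proof. by rewrite (le_trans (normr_ge0 _) (le_norm_variation mu set0)). Qed.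

Lemma ba_normZ (a : R) (mu : ba) :
  ba_norm (a *: mu) = `|a| * ba_norm mu.
Proof.
have leZ b (nu : ba) : ba_norm (b *: nu) <= `|b| * ba_norm nu.
  apply: variation_le => n F mF tF.
  apply: le_trans (ler_wpM2l (normr_ge0 _) (le_variation nu mF tF)).
  by rewrite mulr_sumr; apply: ler_sum => i _; rewrite -normrM.
apply/eqP; rewrite eq_le leZ /=; have [->|a0] := eqVneq a 0.
  by rewrite normr0 mul0r; exact: ba_norm_ge0.
rewrite mulrC -ler_pdivlMr ?normr_gt0 // mulrC -normfV.
by rewrite -[in leLHS](scalerK a0 mu) leZ.
Qed.

Lemma ba_norm_eq0 (mu : ba) : ba_norm mu = 0 -> mu = 0.
Proof.
move=> mu0; apply/val_inj/funext => E /=.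
by have := le_norm_variation mu E; rewrite mu0 normr_le0 => /eqP.
Qed.

HB.instance Definition _ := Lmodule_isNormed.Build R ba
  ba_normD ba_normZ ba_norm_eq0.

Definition countably_additive : set ba :=
  [set mu | semi_sigma_additive (fun E => (mu E)%:E)].

Definition ca_pred : {pred ba} := fun mu => mu \in countably_additive.

Lemma ca_submod_closed : submod_closed ca_pred.
Proof.
split=> [|a mu nu].
  rewrite inE => F _ _ _; rewrite (_ : (fun _ => _) = cst 0%E); first exact: cvg_cst.
  by apply/funext => n; rewrite big1.
rewrite !inE => mus nus F mF tF mUF.
have -> : (fun n => \sum_(0 <= i < n) (ba_val (a *: mu + nu) (F i))%:E)%E =
    (fun n => a%:E * (\sum_(0 <= i < n) (mu (F i))%:E) + \sum_(0 <= i < n) (nu (F i))%:E)%E.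
  apply/funext => n; rewrite !sumEFin -EFinM -EFinD; congr EFin.
  by rewrite mulr_sumr -big_split.
rewrite (_ : ba_val _ _ = a * mu (\bigcup_n F n) + nu (\bigcup_n F n)) //.
rewrite EFinD EFinM.
apply: cvgeD => //; last exact: nus.
by apply: cvgeZl => //; exact: mus.
Qed.

HB.instance Definition _ :=
  GRing.isSubmodClosed.Build R ba ca_pred ca_submod_closed.

Record ca := Ca { ca_val :> ba; _ : ca_val \in ca_pred }.

HB.instance Definition _ := [isSub for ca_val].
HB.instance Definition _ := [Choice of ca by <:].
HB.instance Definition _ := [SubChoice_isSubLmodule of ca by <:].

Definition ca_norm (mu : ca) : R := `|ca_val mu|.

Lemma ca_normD (mu nu : ca) : ca_norm (mu + nu) <= ca_norm mu + ca_norm nu.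
Proof. exact: ler_normD. Qed.

Lemma ca_normZ (a : R) (mu : ca) : ca_norm (a *: mu) = `|a| * ca_norm mu.
Proof. exact: normrZ. Qed.

Lemma ca_norm_eq0 (mu : ca) : ca_norm mu = 0 -> mu = 0.
Proof. by move=> /eqP; rewrite normr_eq0 => /eqP mu0; exact: val_inj. Qed.

HB.instance Definition _ := Lmodule_isNormed.Build R ca
  ca_normD ca_normZ ca_norm_eq0.

End ba.

Section integral.
Context {d : measure_display} (X : measurableType d) (R : realType).
Import HBSimple.
Implicit Types (mu : ba X R) (g h : {sfun X >-> R}) (f : X -> R) (E F : set X).

Definition simple_integral mu g : R :=
  \sum_(y \in range g) y * mu (g @^-1` [set y]).

Definition is_ba_integral mu f : set R := [set I |
  forall e : R, 0 < e -> exists2 dl : R, 0 < dl &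
    forall g, (forall x, `|f x - g x| <= dl) -> `|I - simple_integral mu g| <= e].

(* the integral of a bounded measurable function against a finitely additive
   measure: the limit of the integrals of the uniformly close simple functions *)
Definition ba_integral mu f : R := xget 0 (is_ba_integral mu f).

Lemma simple_integral_rep mu (T : choiceType) (K : X -> T) (c : T -> R) g :
    finite_set (range K) -> (forall t, measurable (K @^-1` [set t])) ->
    (forall x, g x = c (K x)) ->
  simple_integral mu g =
  \sum_(t <- fset_set (range K)) c t * mu (K @^-1` [set t]).
Proof.
move=> fK mK gK; rewrite /simple_integral fsbig_finite; last exact: fimfunP.
set rg := fset_set (range g); set rK := fset_set (range K).
transitivity (\sum_(y <- rg) \sum_(t <- rK | c t == y) c t * mu (K @^-1` [set t])).
  apply: eq_bigr => y _.
  have -> : g @^-1` [set y] = \big[setU/set0]_(t <- rK | c t == y) K @^-1` [set t].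
    rewrite -bigcup_seq_cond; apply/seteqP; split=> [x /= gx|x [t /= /andP[_ /eqP cty]] /= Kxt].
      exists (K x) => //=; rewrite -gK gx eqxx andbT in_fset_set // inE.
      by exists x.
    by rewrite gK Kxt cty.
  rewrite ba_bigU //; last first.
    by move=> t u _ _ [x [/= <- <-]].
  rewrite mulr_sumr; apply: eq_big => // t /eqP -> //.
rewrite (exchange_big_dep xpredT) //=; rewrite !big_seq; apply: eq_bigr => t.
rewrite in_fset_set // inE => -[x _ Kxt].
rewrite -big_filter (@eq_filter _ _ (pred1 (c t))) => [|y]; last by rewrite /= eq_sym.
rewrite filter_pred1_uniq ?big_seq1 //; first exact: fset_uniq.
rewrite in_fset_set ?inE; last exact: fimfunP.
by exists x => //; rewrite gK Kxt.
Qed.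

Lemma le_ba_norm_seq mu (T : choiceType) (s : seq T) (E : T -> set X) :
    uniq s -> (forall t, measurable (E t)) -> trivIset [set` s] E ->
  \sum_(t <- s) `|mu (E t)| <= ba_norm mu.
Proof.
case: s => [|t0 s0]; first by move=> *; rewrite big_nil ba_norm_ge0.
move: (t0 :: s0) => s us mE tE.
rewrite (big_nth t0) big_mkord.
apply: (le_variation mu (F := fun i => E (nth t0 s i))) => // i j /= si sj EE.
have /(congr1 (index^~ s)) := tE _ _ (mem_nth t0 si) (mem_nth t0 sj) EE.
by rewrite !index_uniq.
Qed.

Definition pair2 g h x := (g x, h x).

Lemma pair2_fin g h : finite_set (range (pair2 g h)).
Proof.
apply: (@sub_finite_set _ _ (range g `*` range h)).
  by move=> _ [x _ <-]; split; exists x.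
by apply: finite_setX; exact: fimfunP.
Qed.

Lemma pair2_meas g h t : measurable (pair2 g h @^-1` [set t]).
Proof.
have -> : pair2 g h @^-1` [set t] = g @^-1` [set t.1] `&` h @^-1` [set t.2].
  by apply/seteqP; split=> x /=; rewrite /pair2; [move=> <-|case: t => u v /= [-> ->]].
by apply: measurableI; exact: measurable_sfunP.
Qed.

Lemma pair2_triv g h s : trivIset s (fun t => pair2 g h @^-1` [set t]).
Proof. by move=> t u _ _ [x [/= <- <-]]. Qed.

Lemma simple_integral_dist mu g h (e : R) : 0 <= e ->
    (forall x, `|g x - h x| <= e) ->
  `|simple_integral mu g - simple_integral mu h| <= e * ba_norm mu.
Proof.
move=> e0 gh.
rewrite (@simple_integral_rep mu _ (pair2 g h) fst g) //; [|exact: pair2_fin|exact: pair2_meas].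
rewrite (@simple_integral_rep mu _ (pair2 g h) snd h) //; [|exact: pair2_fin|exact: pair2_meas].
rewrite -sumrB (le_trans (ler_norm_sum _ _ _)) //.
have sn : \sum_(t <- fset_set (range (pair2 g h)))
    `|mu (pair2 g h @^-1` [set t])| <= ba_norm mu.
  by apply: le_ba_norm_seq; [exact: fset_uniq|exact: pair2_meas|exact: pair2_triv].
apply: le_trans (ler_wpM2l e0 sn); rewrite mulr_sumr !big_seq.
apply: ler_sum => t; rewrite in_fset_set ?inE; last exact: pair2_fin.
move=> -[x _ <-] /=.
by rewrite -mulrBl normrM ler_wpM2r // gh.
Qed.

Lemma simple_integralD mu g h :
  simple_integral mu (g + h) = simple_integral mu g + simple_integral mu h.
Proof.
rewrite (@simple_integral_rep mu _ (pair2 g h) (fun t => t.1 + t.2) (g + h)) //; [|exact: pair2_fin|exact: pair2_meas].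
rewrite (@simple_integral_rep mu _ (pair2 g h) fst g) //; [|exact: pair2_fin|exact: pair2_meas].
rewrite (@simple_integral_rep mu _ (pair2 g h) snd h) //; [|exact: pair2_fin|exact: pair2_meas].
by rewrite -big_split; apply: eq_bigr => t _; rewrite mulrDl.
Qed.

Lemma sfun_of_fibers f : finite_set (range f) ->
    (forall y, measurable (f @^-1` [set y])) ->
  exists g : {sfun X >-> R}, g = f :> (X -> R).
Proof.
move=> ff mf.
have mfun_f : measurable_fun setT f.
  move=> _ B mB; rewrite setTI.
  have -> : f @^-1` B = \bigcup_(y in range f `&` B) f @^-1` [set y].
    apply/seteqP; split=> [x Bfx|x [y [_ By] /= ->] //].
    by exists (f x) => //; split=> //; exists x.
  by apply: fin_bigcup_measurable => //; exact: finite_setIl.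
by exists (HB.pack_for {sfun X >-> R} f (isMeasurableFun.Build _ _ _ _ f mfun_f)
  (FiniteImage.Build _ _ f ff)).
Qed.

Lemma sfun_approx f (M e : R) : measurable_fun setT f ->
    (forall x, `|f x| <= M) -> 0 < e ->
  exists g, forall x, `|f x - g x| <= e.
Proof.
move=> mf fM e0.
pose k x := Num.floor (f x / e).
have kP x : (k x)%:~R * e <= f x < (k x + 1)%:~R * e.
  by rewrite -ler_pdivlMr // -ltr_pdivrMr // floor_itv.
pose N := Num.bound (M / e).
have [|y|g gE] := @sfun_of_fibers (fun x => (k x)%:~R * e).
- apply: (@sub_finite_set _ _
    ((fun i : nat => (i%:Z - N%:Z)%:~R * e) @` `I_(N + N).+1)); last first.
    exact/finite_image/finite_II.
  move=> _ [x _ <-].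
  have : `|f x / e| < N%:R.
    have := fM x; rewrite -(ler_pM2r (x := e^-1)) ?invr_gt0 // => fMe.
    rewrite normrM (gtr0_norm (_ : 0 < e^-1)) ?invr_gt0 //.
    apply: le_lt_trans fMe _; apply: archi_boundP.
    by rewrite divr_ge0 ?(ltW e0) // (le_trans _ (fM x)).
  rewrite ltr_norml => /andP[lo hi].
  have kl : - N%:Z <= k x.
    by rewrite /k floor_ge_int mulrNz (ltW lo).
  have ku : k x <= N%:Z.
    by rewrite -(ler_int R) (le_trans (floor_le _)) // ltW.
  exists (absz (k x + N%:Z)).
    by rewrite /= ltnS -lez_nat gez0_abs; lia.
  by rewrite gez0_abs ?addrK //; lia.
- have [[x <-]|nE] := pselect (exists x, (k x)%:~R * e = y); last first.
    rewrite (_ : _ @^-1` _ = set0) //.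
    by rewrite -subset0 => x kx; apply: nE; exists x.
  set m := k x.
  rewrite (_ : _ @^-1` _ = f @^-1` `[m%:~R * e, (m + 1)%:~R * e[).
    by rewrite -[_ @^-1` _]setTI; apply: mf => //; exact: measurable_itv.
  apply/seteqP; split=> z /=; rewrite in_itv /=.
    move=> /(mulIf (lt0r_neq0 e0)) /intr_inj kz.
    by rewrite -kz kP.
  rewrite -ler_pdivlMr // -ltr_pdivrMr // => /floor_def kz.
  by rewrite /k kz.
exists g => x; rewrite gE /=; have /andP[lo hi] := kP x.
rewrite ger0_norm ?subr_ge0 // lerBlDl ltW // (lt_le_trans hi) //.
by rewrite intrD mulrDl mul1r.
Qed.

Lemma ba_integral_sup mu f (M : R) : measurable_fun setT f ->
    (forall x, `|f x| <= M) ->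
  exists I, forall (dl : R) g, 0 <= dl -> (forall x, `|f x - g x| <= dl) ->
    `|I - simple_integral mu g| <= dl * ba_norm mu.
Proof.
move=> mf fM.
pose L := [set r | exists dl g, [/\ 0 <= dl, forall x, `|f x - g x| <= dl
   & r = simple_integral mu g - dl * ba_norm mu]].
have Lub dl g : 0 <= dl -> (forall x, `|f x - g x| <= dl) ->
    ubound L (simple_integral mu g + dl * ba_norm mu).
  move=> dl0 fg _ [dl' [g' [dl'0 fg' ->]]].
  rewrite lerBlDr -addrA -mulrDl -lerBlDl.
  rewrite (le_trans (ler_norm _)) // simple_integral_dist ?addr_ge0 // => x.
  have := fg x; have := fg' x; rewrite !ler_norml => /andP[? ?] /andP[? ?].
  by apply/andP; split; lra.
have [g0 fg0] := sfun_approx mf fM (@ltr01 R).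
exists (sup L) => dl g dl0 fg.
rewrite ler_distl; apply/andP; split.
  apply: ub_le_sup; first by exists (simple_integral mu g0 + 1 * ba_norm mu); exact: Lub.
  by exists dl, g.
apply: ge_sup; last exact: Lub.
by exists (simple_integral mu g - dl * ba_norm mu), dl, g.
Qed.

Lemma ba_integralP mu f (M : R) : measurable_fun setT f ->
    (forall x, `|f x| <= M) ->
  is_ba_integral mu f (ba_integral mu f) /\
  forall (dl : R) g, 0 <= dl -> (forall x, `|f x - g x| <= dl) ->
    `|ba_integral mu f - simple_integral mu g| <= dl * ba_norm mu.
Proof.
move=> mf fM; have [I HI] := ba_integral_sup mu mf fM.
have nmu := ba_norm_ge0 mu.
have isI : is_ba_integral mu f I.
  move=> e e0; exists (e / (ba_norm mu + 1)); first by rewrite divr_gt0 // ltr_wpDl.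
  move=> g fg; have dl0 : 0 <= e / (ba_norm mu + 1).
    by rewrite divr_ge0 ?(ltW e0) // addr_ge0.
  rewrite (le_trans (HI _ _ dl0 fg)) // mulrAC ler_pdivrMr ?ltr_wpDl //.
  by rewrite ler_pM2l // lerDl.
suff -> : ba_integral mu f = I by [].
apply: xget_unique => // J isJ.
apply/eqP; rewrite -subr_eq0 -normr_le0; apply/ler_addgt0Pr => e e0; rewrite add0r.
have e20 : 0 < e / 2 by rewrite divr_gt0.
have [d1 d10 H1] := isI _ e20; have [d2 d20 H2] := isJ _ e20.
have d0 : 0 < Num.min d1 d2 by rewrite lt_min d10.
have [g fg] := sfun_approx mf fM d0.
have fg1 x : `|f x - g x| <= d1 by rewrite (le_trans (fg x)) // ge_min lexx.
have fg2 x : `|f x - g x| <= d2 by rewrite (le_trans (fg x)) // ge_min lexx orbT.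
have := H1 _ fg1; have := H2 _ fg2.
rewrite !ler_norml => /andP[? ?] /andP[? ?]; apply/andP; split; lra.
Qed.

Lemma ba_integral_eq mu f (M C I : R) : measurable_fun setT f ->
    (forall x, `|f x| <= M) ->
    (forall e g, 0 < e -> (forall x, `|f x - g x| <= e) ->
      `|I - simple_integral mu g| <= e * C) ->
  ba_integral mu f = I.
Proof.
move=> mf fM HI.
have [_ HJ] := ba_integralP mu mf fM.
apply/eqP; rewrite -subr_eq0 -normr_le0; apply/ler_addgt0Pr => e e0; rewrite add0r.
pose K := `|C| + ba_norm mu + 1.
have K0 : 0 < K by rewrite ltr_wpDl // addr_ge0 ?ba_norm_ge0.
have eK0 : 0 < e / K by rewrite divr_gt0.
have [g fg] := sfun_approx mf fM eK0.
rewrite -(subrKA (simple_integral mu g)) (le_trans (ler_normD _ _)) //.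
have h1 := HI _ _ eK0 fg; have h2 := HJ _ _ (ltW eK0) fg.
rewrite distrC in h1; rewrite (le_trans (lerD h2 h1)) //.
rewrite -mulrDr mulrAC ler_pdivrMr // ler_pM2l // /K.
have := ler_norm C; lra.
Qed.

Lemma ba_integralD mu f1 f2 (M1 M2 : R) :
    measurable_fun setT f1 -> (forall x, `|f1 x| <= M1) ->
    measurable_fun setT f2 -> (forall x, `|f2 x| <= M2) ->
  ba_integral mu (fun x => f1 x + f2 x) = ba_integral mu f1 + ba_integral mu f2.
Proof.
move=> mf1 fM1 mf2 fM2.
have [_ H1] := ba_integralP mu mf1 fM1; have [_ H2] := ba_integralP mu mf2 fM2.
have mf : measurable_fun setT (fun x => f1 x + f2 x) by exact: measurable_funD.
have fM x : `|f1 x + f2 x| <= M1 + M2 by rewrite (le_trans (ler_normD _ _)) // lerD.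
apply: (ba_integral_eq (C := 5 * ba_norm mu) mf fM) => e g e0 fg.
have [g1 fg1] := sfun_approx mf1 fM1 e0; have [g2 fg2] := sfun_approx mf2 fM2 e0.
have h1 := H1 _ _ (ltW e0) fg1; have h2 := H2 _ _ (ltW e0) fg2.
have gg x : `|(g1 + g2) x - g x| <= 3 * e.
  have := fg x; have := fg1 x; have := fg2 x.
  rewrite -[(g1 + g2) x]/(g1 x + g2 x) !ler_norml => /andP[? ?] /andP[? ?] /andP[? ?].
  apply/andP; split; lra.
have e30 : 0 <= 3 * e by rewrite mulr_ge0 // ltW.
have := simple_integral_dist mu e30 gg; rewrite simple_integralD.
move: h1 h2; rewrite !ler_norml => /andP[? ?] /andP[? ?] /andP[? ?].
by apply/andP; split; lra.
Qed.

Lemma ba_integral_bound mu f (M : R) : 0 <= M -> measurable_fun setT f ->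
  (forall x, `|f x| <= M) -> `|ba_integral mu f| <= M * ba_norm mu.
Proof.
move=> M0 mf fM; have [_ H] := ba_integralP mu mf fM.
have s0 : simple_integral mu 0 = 0.
  have := simple_integralD mu 0 0; rewrite addr0 => /eqP.
  by rewrite -subr_eq0 opprD addrA subrr sub0r oppr_eq0 => /eqP.
by have := H M 0 M0; rewrite s0 subr0; apply => x; rewrite subr0.
Qed.

End integral.

Section ca_integral.
Context {d : measure_display} (X : measurableType d) (R : realType).
Import HBSimple.
Implicit Types (mu : ba X R) (g h : {sfun X >-> R}) (f : X -> R) (E F : set X).

Section ca_charge.
Variables (mu : ba X R) (mus : countably_additive mu).

Definition ca_charge : set X -> \bar R := let _ := mus in fun E => (mu E)%:E.

Lemma ca_charge0 : ca_charge set0 = 0%E.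
Proof. by rewrite /ca_charge ba_set0. Qed.

Lemma ca_charge_fin E : measurable E -> ca_charge E \is a fin_num.
Proof. by []. Qed.

HB.instance Definition _ :=
  isCharge.Build _ _ _ ca_charge ca_charge0 ca_charge_fin mus.

End ca_charge.

Lemma ca_jordan mu : countably_additive mu ->
  exists m1 m2 : FiniteMeasure.type X R,
    forall E, measurable E -> mu E = fine (m1 E) - fine (m2 E).
Proof.
move=> mus; have [P [N nuPN]] := Hahn_decomposition (ca_charge mus).
pose m1 : FiniteMeasure.type X R := jordan_pos nuPN.
pose m2 : FiniteMeasure.type X R := jordan_neg nuPN.
exists m1, m2 => E mE.
have := jordan_decomp nuPN mE; rewrite /cadd /= cscaleN1.
have f1 : jordan_pos nuPN E \is a fin_num by exact: fin_num_measure.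
have f2 : jordan_neg nuPN E \is a fin_num by exact: fin_num_measure.
by move=> muE; rewrite -fineB // -muE.
Qed.

Lemma bounded_integrable (m : FiniteMeasure.type X R) f (M : R) :
  measurable_fun setT f -> (forall x, `|f x| <= M) -> m.-integrable setT (EFin \o f).
Proof.
move=> mf fM; apply: measurable_bounded_integrable => //.
  by rewrite -ge0_fin_numE // fin_num_measure.
exists M; split; first exact: num_real.
by move=> y My x _ /=; rewrite (le_trans (fM x)) // ltW.
Qed.

Lemma sfun_bounded g : exists M, forall x, `|g x| <= M.
Proof.
have /fset_setK rg := @fimfunP _ _ g.
exists (\sum_(y <- fset_set (range g)) `|y|) => x.
have gx : g x \in fset_set (range g) by rewrite in_fset_set ?inE //; exact: imageP.
rewrite (bigD1_seq (g x)) //=; last exact: fset_uniq.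
by rewrite lerDl sumr_ge0.
Qed.

Lemma sfun_Rintegral (m : FiniteMeasure.type X R) g :
  \int[m]_x g x = \sum_(y \in range g) y * fine (m (g @^-1` [set y])).
Proof.
transitivity (\int[m]_x (\sum_(y <- fset_set (range g)) y * \1_(g @^-1` [set y]) x)).
  by apply: eq_Rintegral => x _; rewrite {1}fimfunE fsbig_finite.
rewrite fsbig_finite //.
have mg y : measurable (g @^-1` [set y]) by exact: measurable_sfunP.
have ind y : m.-integrable setT (EFin \o (\1_(g @^-1` [set y]) : X -> R)).
  exact: integrable_indic.
elim: (enum_fset (fset_set (range g))) => [|y s ih].
  rewrite big_nil; under eq_Rintegral do rewrite big_nil.
  by rewrite Rintegral_cst // mul0r.
rewrite big_cons -ih; under eq_Rintegral do rewrite big_cons.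
rewrite RintegralD //.
- rewrite RintegralZl //; congr (_ * _ + _).
  by rewrite /Rintegral integral_indic // setIT.
- by have := integrableZl measurableT y (ind y).
- have : m.-integrable setT (fun x => \sum_(j <- s) (j%:E * (EFin \o (\1_(g @^-1` [set j]) : X -> R)) x))%E.
    apply: integrable_sum => // j _; exact: integrableZl.
  congr (m.-integrable _ _); apply/funext => x /=.
  by rewrite -sumEFin.
Qed.

Lemma ca_integralE mu (m1 m2 : FiniteMeasure.type X R) f (M : R) :
    (forall E, measurable E -> mu E = fine (m1 E) - fine (m2 E)) ->
    measurable_fun setT f -> (forall x, `|f x| <= M) ->
  ba_integral mu f = \int[m1]_x f x - \int[m2]_x f x.
Proof.
move=> mum mf fM.
apply: (ba_integral_eq (C := fine (m1 setT) + fine (m2 setT)) mf fM) => e g e0 fg.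
have mg y : measurable (g @^-1` [set y]) by exact: measurable_sfunP.
have -> : simple_integral mu g = \int[m1]_x g x - \int[m2]_x g x.
  rewrite !sfun_Rintegral /simple_integral !fsbig_finite //.
  by rewrite -sumrB; apply: eq_bigr => y _; rewrite mum // mulrBr.
have [N gN] := sfun_bounded g.
have key (m : FiniteMeasure.type X R) :
    `|\int[m]_x f x - \int[m]_x g x| <= e * fine (m setT).
  have If := bounded_integrable m mf fM.
  have Ig := bounded_integrable m (measurable_funPT g) gN.
  have mfg : measurable_fun setT (fun x => f x - g x).
    by apply: measurable_funB.
  rewrite -RintegralB //.
  have Ifg := bounded_integrable m mfg fg.
  rewrite (le_trans (le_normr_Rintegral _ Ifg)) //.
  rewrite -Rintegral_cst //; apply: le_Rintegral => //.
    apply: (@bounded_integrable _ _ e); last by move=> x; rewrite normr_id.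
    by apply: measurableT_comp.
  apply: (@bounded_integrable _ _ e) => // _.
  by rewrite ger0_norm // ltW.
have := key m1; have := key m2; rewrite !ler_norml => /andP[? ?] /andP[? ?].
by apply/andP; split; lra.
Qed.

End ca_integral.

(* A probability kernel P : R.-pker X ~> X is exactly a transition function
   p(x, E) = fine (P x E). *)
Section markov.
Context {d : measure_display} (X : measurableType d) (R : realType).
Variable P : R.-pker X ~> X.
Implicit Types (mu : ba X R) (E F : set X).

Definition markov_fun mu E : R :=
  if `[< measurable E >] then ba_integral mu (fun x => fine (P x E)) else 0.

Lemma kernel_fin_num x E : measurable E -> P x E \is a fin_num.
Proof.
move=> mE; rewrite ge0_fin_numE // (@le_lt_trans _ _ 1%E) ?ltry //.
by rewrite -(prob_kernel (s := P) x); apply: le_measure; rewrite ?inE.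
Qed.

Lemma measurable_fine_kernel E : measurable E -> measurable_fun setT (fun x => fine (P x E)).
Proof. move=> mE.
have mfine : measurable_fun [set: \bar R] (fine : \bar R -> R).
  exact: fine_measurable.
exact: (measurableT_comp mfine (measurable_kernel P E mE)). Qed.

Lemma fine_kernel_le1 E : measurable E -> forall x, `|fine (P x E)| <= 1.
Proof.
move=> mE x; rewrite ger0_norm ?fine_ge0 // -lee_fin fineK ?kernel_fin_num //.
by rewrite -(prob_kernel (s := P) x); apply: le_measure; rewrite ?inE.
Qed.

Lemma markov_fun_ba mu : markov_fun mu \in ba_pred (X := X) (R := R).
Proof.
rewrite inE; split.
- by move=> E nE; rewrite /markov_fun asboolF.
- move=> E F mE mF EF; rewrite /markov_fun !asboolT //; last exact: measurableU.
  rewrite -(ba_integralD mu (measurable_fine_kernel mE) (fine_kernel_le1 mE) (measurable_fine_kernel mF) (fine_kernel_le1 mF)).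
  congr ba_integral; apply/funext => x.
  by rewrite measureU // fineD // kernel_fin_num.
- exists (1 * ba_norm mu) => E mE; rewrite /markov_fun asboolT //.
  by apply: ba_integral_bound => //; [exact: measurable_fine_kernel|exact: fine_kernel_le1].
Qed.

Definition markov_op mu : ba X R := Ba (markov_fun_ba mu).

Lemma markov_op_ca mu : countably_additive mu -> countably_additive (markov_op mu).
Proof.
move=> /ca_jordan[m1 [m2 mum]] F mF tF mUF.
have markE E : measurable E -> markov_op mu E =
    \int[m1]_x fine (P x E) - \int[m2]_x fine (P x E).
  move=> mE; rewrite /= /markov_fun asboolT //.
  exact: ca_integralE mum (measurable_fine_kernel mE) (fine_kernel_le1 mE).
have key (m : FiniteMeasure.type X R) :
    (\sum_(0 <= i < n) (\int[m]_x fine (P x (F i)))%:E)%E @[n --> \oo] -->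
    (\int[m]_x fine (P x (\bigcup_n F n)))%:E.
  have RE E : measurable E -> (\int[m]_x fine (P x E))%:E = (\int[m]_x P x E)%E.
    move=> mE; rewrite /Rintegral fineK; last first.
      apply: integrable_fin_num => //.
      exact: bounded_integrable (measurable_fine_kernel mE) (fine_kernel_le1 mE).
    by apply: eq_integral => x _; rewrite fineK // kernel_fin_num.
  rewrite RE //.
  under eq_fun do under eq_bigr do rewrite RE //.
  have -> : (\int[m]_x P x (\bigcup_n F n) = \sum_(0 <= i <oo) \int[m]_x P x (F i))%E.
    rewrite -integral_nneseries //; last by move=> n; exact: measurable_kernel.
    apply: eq_integral => x _; apply/esym/cvg_lim => //.
    exact: measure_semi_sigma_additive.
  by apply: is_cvg_nneseries => n _ _; exact: integral_ge0.
rewrite markE // EFinB.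
have -> : (fun n => \sum_(0 <= i < n) (markov_op mu (F i))%:E)%E =
  (fun n => (\sum_(0 <= i < n) (\int[m1]_x fine (P x (F i)))%:E) -
     \sum_(0 <= i < n) (\int[m2]_x fine (P x (F i)))%:E)%E.
  apply/funext => n; rewrite !sumEFin -EFinB -sumrB; congr EFin.
  by apply: eq_bigr => i _; rewrite markE.
by apply: cvgeB => //; exact: key.
Qed.

Lemma markov_ca_subproof (mu : ca X R) : markov_op mu \in ca_pred (X := X) (R := R).
Proof.
case: mu => mu muca; apply/mem_set; apply: markov_op_ca; exact: set_mem muca.
Qed.

Definition markov_ca (mu : ca X R) : ca X R := Ca (markov_ca_subproof mu).

Definition S_ba : set (ba X R) :=
  [set mu : ba X R | (forall E, measurable E -> 0 <= mu E) /\ `|mu| = 1].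

Definition Delta_ba : set (ba X R) := [set mu : ba X R | S_ba mu /\ markov_op mu = mu].

End markov.

Section operators.
Context {R : realType} {V W : normedModType R}.

Definition compact_operator (f : {linear V -> W}) : Prop :=
  forall B : set V, bounded_set B -> precompact (f @` B).

(* valued in \bar R, so that it is +oo (and not a default value) when f is
   unbounded on the unit ball *)
Definition op_norm (f : V -> W) : \bar R :=
  ereal_sup [set (`|f v|)%:E | v in [set v : V | `|v| <= 1]].

End operators.

Definition quasicompact {R : realType} {V : normedModType R} (f : V -> V) : Prop :=
  exists f1 : {linear V -> V}, compact_operator f1 /\
    exists2 k : nat, (1 <= k)%N & (op_norm (fun x => iter k f x - f1 x)%R < 1)%E.

(* Main.v *)
From HB Require Import structures.
Require Import Defs.
From mathcomp Require Import all_boot all_order all_algebra.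
From mathcomp Require Import finmap.
From mathcomp Require Import all_classical all_reals all_analysis.
From mathcomp Require Import measurable_realfun.
From mathcomp Require Import zify ring lra.

Set Implicit Arguments.
Unset Strict Implicit.
Unset Printing Implicit Defensive.

Import Order.TTheory GRing.Theory Num.Theory.
Import numFieldTopology.Exports numFieldNormedType.Exports.

Local Open Scope classical_set_scope.
Local Open Scope ring_scope.

(** If the Cesaro averages of p^i(x, .) were not uniformly absolutely continuous
    with respect to some countably additive lam, one could choose greedily points
    x_n and sets E_n carrying mass > e for the n-th average at x_n while being
    summably small for all earlier averages. A limit of the averages along a free
    ultrafilter is an invariant mean, countably additive by hypothesis, giving
    limsup E_n both mass 0 and mass >= e. Uniform absolute continuity passes from
    averages to a single power p^k, giving a Doeblin condition: lam E < dl
    implies p^k(x, E) <= e for all x.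

    Next, a second greedy choice (of sets E_n, refining at each step a finite
    partition by E_n) yields functions f_n = 1_{E_n} - E[1_{E_n} | partition],
    orthogonal in L^2(lam) and bounded by 1. By the Doeblin condition the averages
    of |p^k f_n| are uniformly small, so the choice must stop: for some finite
    partition, p^k (1_E - E[1_E | partition]) is small in L^1 for every E.
    A further power makes this uniform in x, hence x |-> p^k(x, .) oscillates little
    in total variation on the cells Q_i of a finite partition of X, and A^k is close
    to the finite rank operator mu |-> sum_i mu(Q_i) p^k(x_i, .) with x_i in Q_i. *)

(** * Integration of bounded measurable functions against finitely additive measures *)

Section ba_integral_theory.
Context {d : measure_display} (X : measurableType d) (R : realType).
Import HBSimple.
Implicit Types (mu nu : ba X R) (g h : {sfun X >-> R}) (f : X -> R) (E F : set X).

Definition bounded_measurable f :=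
  measurable_fun setT f /\ exists M : R, forall x, `|f x| <= M.

Local Notation bm := bounded_measurable.

Lemma bm_cst (c : R) : bm (fun=> c).
Proof. by split; [exact: measurable_cst|exists `|c|]. Qed.

Lemma bm_indic E : measurable E -> bm (\1_E : X -> R).
Proof.
move=> mE; split; first exact: measurable_indic.
by exists 1 => x; rewrite indicE; case: (_ \in _); rewrite ?normr1 ?normr0.
Qed.

Lemma bmD f1 f2 : bm f1 -> bm f2 -> bm (fun x => f1 x + f2 x).
Proof.
move=> [mf [M fM]] [mg [N gN]]; split; first exact: measurable_funD.
by exists (M + N) => x; rewrite (le_trans (ler_normD _ _)) // lerD.
Qed.

Lemma bmM f1 f2 : bm f1 -> bm f2 -> bm (fun x => f1 x * f2 x).
Proof.
move=> [mf [M fM]] [mg [N gN]]; split; first exact: measurable_funM.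
by exists (M * N) => x; rewrite normrM ler_pM.
Qed.

Lemma bmZ (a : R) f : bm f -> bm (fun x => a * f x).
Proof. exact: (bmM (bm_cst a)). Qed.

Lemma bmB f1 f2 : bm f1 -> bm f2 -> bm (fun x => f1 x - f2 x).
Proof.
move=> b1 /(bmZ (-1)) /(bmD b1).
by congr (bm _); apply/funext => x; rewrite mulN1r.
Qed.

Lemma bm_norm f : bm f -> bm (fun x => `|f x|).
Proof.
move=> [mf [M fM]]; split; first exact: measurableT_comp.
by exists M => x; rewrite normr_id.
Qed.

Lemma bm_sum (I : Type) (s : seq I) (f : I -> X -> R) :
  (forall i, bm (f i)) -> bm (fun x => \sum_(i <- s) f i x).
Proof.
move=> bf; elim: s => [|i s ih].
  by under eq_fun do rewrite big_nil; exact: bm_cst.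
by under eq_fun do rewrite big_cons; exact: bmD.
Qed.

Lemma bm_ge f (c : R) : bm f -> measurable [set x | c <= f x].
Proof.
move=> [mf _]; rewrite (_ : mkset _ = f @^-1` `[c, +oo[).
  by rewrite -[_ @^-1` _]setTI; apply: mf => //; exact: measurable_itv.
by apply/seteqP; split => x /=; rewrite in_itv /= andbT.
Qed.

(** Used to see that integrating a function against a transition kernel gives a measurable function
    of the starting point, once this is known for simple functions. *)
Lemma bm_uniform_limit f :
  (forall e : R, 0 < e -> exists2 g : X -> R, bm g & forall x, `|f x - g x| <= e) -> bm f.
Proof.
move=> fg; split; last first.
  have [g [_ [M gM]] fg1] := fg 1 ltr01; exists (1 + M) => x.
  by rewrite -(subrK (g x) (f x)) (le_trans (ler_normD _ _)) // lerD.
have /choice[h hP] : forall n, exists g : X -> R, bm g /\ forall x, `|f x - g x| <= n.+1%:R^-1.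
  by move=> n; have [|g bg fgn] := fg n.+1%:R^-1; [rewrite invr_gt0|exists g].
apply: (@measurable_fun_cvg _ _ _ _ h); first by move=> n; have [[]] := hP n.
move=> x _; apply/cvgrPdist_le => e e0.
near=> n; have [_ /(_ x)] := hP n; move/le_trans; apply.
by near: n; apply: filterS (near_infty_natSinv_lt (PosNum e0)) => n /ltW.
Unshelve. all: by end_near. Qed.

Lemma simple_integralZ mu (a : R) g :
  simple_integral mu (scale_sfun a g) = a * simple_integral mu g.
Proof.
rewrite (@simple_integral_rep _ _ _ mu _ g (fun y => y * a) (scale_sfun a g)) //.
rewrite (@simple_integral_rep _ _ _ mu _ g id g) //.
by rewrite mulr_sumr; apply: eq_bigr => y _; rewrite mulrA (mulrC y).
Qed.

Lemma simple_integral_indic mu E (mE : measurable E) :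
  simple_integral mu (indic_sfun E mE) = mu E.
Proof.
have KE (b : bool) : (fun x => x \in E) @^-1` [set b] = if b then E else ~` E.
  case: b; apply/seteqP; split => x /=; [exact: set_mem|exact: mem_set| |exact: memNset].
  by move=> + Ex; rewrite mem_set.
have fE : finite_set (range (fun x => x \in E)) by exact: finite_finset.
rewrite (@simple_integral_rep _ _ _ mu _ (fun x => x \in E) (fun b : bool => b%:R)) //.
- rewrite (eq_bigr (fun b : bool => b%:R * mu (if b then E else ~` E))); last by move=> b _; rewrite KE.
  have [E0|/set0P[x Ex]] := eqVneq E set0.
    rewrite [RHS](_ : _ = 0); last by rewrite E0 ba_set0.
    rewrite big1_seq // => -[] /=; last by rewrite mul0r.
    by rewrite in_fset_set // inE => -[x _ /set_mem]; rewrite E0.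
  rewrite (bigD1_seq true) ?fset_uniq //=; last first.
    by rewrite in_fset_set // inE; exists x => //; exact: mem_set.
  by rewrite mul1r big1 ?addr0 // => -[] //; rewrite mul0r.
- by move=> b; rewrite KE; case: b => //; exact: measurableC.
Qed.

Lemma ba_integral_simple mu g : ba_integral mu g = simple_integral mu g.
Proof.
have [M gM] := sfun_bounded g.
apply: (ba_integral_eq (C := ba_norm mu) (measurable_funPT g) gM) => e h e0 gh.
exact: simple_integral_dist (ltW e0) gh.
Qed.

Lemma bint_indicE mu E : measurable E -> ba_integral mu \1_E = mu E.
Proof.
by move=> mE; rewrite -(simple_integral_indic mu mE) -ba_integral_simple.
Qed.

Lemma bintD mu f1 f2 : bm f1 -> bm f2 ->
  ba_integral mu (fun x => f1 x + f2 x) = ba_integral mu f1 + ba_integral mu f2.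
Proof. by move=> [mf [M fM]] [mg [N gN]]; exact: ba_integralD mf fM mg gN. Qed.

Lemma bm_approx f (e : R) : bm f -> 0 < e -> exists g, forall x, `|f x - g x| <= e.
Proof. by move=> [mf [M fM]] e0; exact: sfun_approx mf fM e0. Qed.

Lemma bint_dist mu f g (e : R) : bm f -> 0 <= e -> (forall x, `|f x - g x| <= e) ->
  `|ba_integral mu f - simple_integral mu g| <= e * ba_norm mu.
Proof. by move=> [mf [M fM]]; have [_] := ba_integralP mu mf fM; exact. Qed.

Lemma bint_eq mu f (C I : R) : bm f ->
    (forall e g, 0 < e -> (forall x, `|f x - g x| <= e) ->
      `|I - simple_integral mu g| <= e * C) ->
  ba_integral mu f = I.
Proof. by move=> [mf [M fM]]; exact: ba_integral_eq mf fM. Qed.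

Lemma bintZ mu (a : R) f : bm f ->
  ba_integral mu (fun x => a * f x) = a * ba_integral mu f.
Proof.
(* With [h] simple and within e of f, replacing f by [h] costs |a| e, and [a * h] differs from [g]
   by at most (|a| + 1) e; the constant collects both. *)
move=> bf; apply: (bint_eq (C := (2 * `|a| + 1) * ba_norm mu) (bmZ a bf)) => e g e0 fg.
have [h fh] := bm_approx bf e0; have fhI := bint_dist mu bf (ltW e0) fh.
have ahg x : `|scale_sfun a h x - g x| <= (`|a| + 1) * e.
  have -> : scale_sfun a h x - g x = (a * f x - g x) - a * (f x - h x).
    have -> : scale_sfun a h x = a * h x by rewrite mulrC.
    by rewrite mulrBr; lra.
  rewrite (le_trans (ler_normB _ _)) // normrM mulrDl mul1r addrC lerD //.
  by rewrite ler_wpM2l.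
have := simple_integral_dist mu _ ahg; rewrite simple_integralZ => /(_ _) dist.
rewrite -(subrKA (a * simple_integral mu h)) (le_trans (ler_normD _ _)) //.
rewrite -mulrBr normrM.
have -> : e * ((2 * `|a| + 1) * ba_norm mu) =
  `|a| * (e * ba_norm mu) + (`|a| + 1) * e * ba_norm mu by ring.
rewrite lerD //; first by rewrite ler_wpM2l.
by apply: dist; rewrite mulr_ge0 ?addr_ge0 // ltW.
Qed.

Lemma bintB mu f1 f2 : bm f1 -> bm f2 ->
  ba_integral mu (fun x => f1 x - f2 x) = ba_integral mu f1 - ba_integral mu f2.
Proof.
move=> b1 b2; rewrite -[- ba_integral mu f2]mulN1r -bintZ // -bintD //.
  by congr ba_integral; apply/funext => x; rewrite mulN1r.
exact: bmZ.
Qed.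

Lemma bint_sum mu (I : Type) (s : seq I) (f : I -> X -> R) : (forall i, bm (f i)) ->
  ba_integral mu (fun x => \sum_(i <- s) f i x) = \sum_(i <- s) ba_integral mu (f i).
Proof.
move=> bf; elim: s => [|i s ih].
  rewrite big_nil; under eq_fun do rewrite big_nil.
  by have := bintZ mu 0 (bm_cst 0); rewrite !mul0r.
rewrite big_cons -ih -bintD //; last exact: bm_sum.
by congr ba_integral; apply/funext => x; rewrite big_cons.
Qed.

Lemma bint_cst mu (c : R) : ba_integral mu (fun=> c) = c * mu setT.
Proof.
rewrite -(bint_indicE mu measurableT) -bintZ; last exact: bm_indic.
by congr ba_integral; apply/funext => x; rewrite indicT mulr1.
Qed.

Lemma bint_norm_le mu f (M : R) : bm f -> 0 <= M -> (forall x, `|f x| <= M) ->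
  `|ba_integral mu f| <= M * ba_norm mu.
Proof. by move=> [mf _] M0 fM; exact: ba_integral_bound. Qed.

(** Quantifying over all sets is harmless, since elements of [ba] vanish outside the
    sigma-algebra. *)
Definition ba_ge0 mu := forall E, 0 <= mu E.

Lemma ba_ge0_norm mu : ba_ge0 mu -> ba_norm mu = mu setT.
Proof.
move=> mu0; apply/eqP; rewrite eq_le; apply/andP; split; last first.
  by rewrite (le_trans (ler_norm _)) // le_norm_variation.
apply: Defs.variation_le => n F mF tF.
rewrite (eq_bigr (fun i : 'I_n => mu (F i))) => [|i _]; last by rewrite ger0_norm.
rewrite -(big_mkord xpredT (fun i => mu (F i))) -ba_bigU //; last 2 first.
- exact: iota_uniq.
- by apply: sub_trivIset tF => i /=; rewrite mem_index_iota.
set G := \big[setU/set0]_(_ <- _) _.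
have mG : measurable G by apply: bigsetU_measurable.
have <- : G `|` ~` G = setT by rewrite setUCr.
by rewrite ba_add ?lerDl //; [exact: measurableC|rewrite setICr].
Qed.

(** If f takes values in [0, M], it stays within M/2 of the constant M/2, so its integral stays
    within (M/2) mu(X) of (M/2) mu(X). *)
Lemma bint_ge0 mu f : ba_ge0 mu -> bm f -> (forall x, 0 <= f x) ->
  0 <= ba_integral mu f.
Proof.
move=> mu0 bf f0; have [_ [M fM]] := bf.
pose c := M / 2.
have fc x : `|f x - c| <= c.
  by have := f0 x; have := fM x; rewrite ger0_norm // ler_norml /c => ? ?; lra.
(* A point of X is what shows M to be nonnegative; on an empty X, f is the zero function. *)
have [[x _]|X0] := pselect ([set: X] !=set0); last first.
  by rewrite -(_ : (fun=> 0) = f) ?bint_cst ?mul0r //;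
    apply/funext => x; exfalso; apply: X0; exists x.
have c0 : 0 <= c by rewrite (le_trans _ (fc x)).
have := bint_norm_le mu (bmB bf (bm_cst c)) c0 fc.
rewrite bintB //; last exact: bm_cst.
by rewrite bint_cst ba_ge0_norm // ler_norml; lra.
Qed.

Lemma bint_le mu f1 f2 : ba_ge0 mu -> bm f1 -> bm f2 -> (forall x, f1 x <= f2 x) ->
  ba_integral mu f1 <= ba_integral mu f2.
Proof.
move=> mu0 b1 b2 f12; rewrite -subr_ge0 -bintB //.
by apply: bint_ge0 => [//||x]; [exact: bmB|rewrite subr_ge0].
Qed.

Lemma le_bint_norm mu f : ba_ge0 mu -> bm f ->
  `|ba_integral mu f| <= ba_integral mu (fun x => `|f x|).
Proof.
move=> mu0 bf; rewrite ler_norml -mulN1r -bintZ; last exact: bm_norm.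
have bn := bm_norm bf.
apply/andP; split; apply: bint_le => //; first exact: bmZ.
- by move=> x; rewrite mulN1r lerNl ler_normr lexx orbT.
- by move=> x; exact: ler_norm.
Qed.

Lemma markov_ineq mu f (c : R) : ba_ge0 mu -> bm f -> (forall x, 0 <= f x) ->
  c * mu [set x | c <= f x] <= ba_integral mu f.
Proof.
move=> mu0 bf f0; have mc := bm_ge c bf.
rewrite -bint_indicE // -bintZ; last exact: bm_indic.
apply: bint_le => //; first by apply: bmZ; exact: bm_indic.
move=> x; rewrite indicE; case: (boolP (_ \in _)) => [|_]; last by rewrite mulr0.
by rewrite inE mulr1.
Qed.

Lemma ba_subset mu E F : ba_ge0 mu -> measurable E -> measurable F -> E `<=` F ->
  mu E <= mu F.
Proof.
move=> mu0 mE mF EF; rewrite -!bint_indicE //.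
apply: bint_le => //; [exact: bm_indic|exact: bm_indic|].
move=> x; rewrite !indicE; case: (boolP (x \in E)) => // /set_mem /EF Fx.
by rewrite mem_set.
Qed.

Lemma ba_eqP mu nu : (forall E, measurable E -> mu E = nu E) -> mu = nu.
Proof.
move=> eq_mn; apply/val_inj/funext => E.
have [mE|nE] := pselect (measurable E); first exact: eq_mn.
by rewrite -[LHS]/(mu E) -[RHS]/(nu E) !ba_nmeas.
Qed.

Lemma ba_linE (a : R) mu nu E : (a *: mu + nu) E = a * mu E + nu E.
Proof. by []. Qed.

Lemma simple_integral_lin (a : R) mu nu g :
  simple_integral (a *: mu + nu) g = a * simple_integral mu g + simple_integral nu g.
Proof.
rewrite /simple_integral !fsbig_finite // mulr_sumr -big_split.
by apply: eq_bigr => y _; rewrite ba_linE mulrDr mulrCA.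
Qed.

Lemma bint_lin (a : R) mu nu f : bm f ->
  ba_integral (a *: mu + nu) f = a * ba_integral mu f + ba_integral nu f.
Proof.
move=> bf; apply: (bint_eq (C := `|a| * ba_norm mu + ba_norm nu) bf) => e g e0 fg.
rewrite simple_integral_lin opprD addrACA -mulrBr (le_trans (ler_normD _ _)) //.
rewrite normrM mulrDr mulrCA lerD //.
  by rewrite ler_wpM2l // bint_dist // ltW.
by rewrite bint_dist // ltW.
Qed.

Lemma bint_measure0 f : bm f -> ba_integral (0 : ba X R) f = 0.
Proof.
move=> bf; have := bint_lin (-1) 0 0 bf.
by rewrite scaler0 add0r mulN1r addNr.
Qed.

End ba_integral_theory.

Notation bm := bounded_measurable.

(** * Point masses, iterated kernels and the duality between measures and functions *)

Section markov_kernels.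
Context {d : measure_display} (X : measurableType d) (R : realType).
Import HBSimple.
Implicit Types (mu nu : ba X R) (f : X -> R) (E F : set X).

Definition dirac_fun (x : X) E : R := if `[< measurable E >] then \1_E x else 0.

Lemma dirac_fun_ba x : dirac_fun x \in ba_pred (X := X) (R := R).
Proof.
rewrite inE; split=> [E nE|E F mE mF EF|].
- by rewrite /dirac_fun asboolF.
- rewrite /dirac_fun !asboolT //; last exact: measurableU.
  by rewrite !indicE in_setU; move/disj_set2P : EF => /disj_setPS EF;
     case: (boolP (x \in E)); case: (boolP (x \in F)) => /=;
     rewrite ?addr0 ?add0r // => /set_mem Fx /set_mem Ex; case: (EF x).
- exists 1 => E mE; rewrite /dirac_fun asboolT // indicE.
  by case: (_ \in _); rewrite ?normr1 ?normr0.
Qed.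

Definition ba_dirac x : ba X R := Ba (dirac_fun_ba x).

Lemma ba_diracE x E : measurable E -> ba_dirac x E = \1_E x.
Proof. by move=> mE; rewrite /= /dirac_fun asboolT. Qed.

Lemma ba_dirac_ge0 x : ba_ge0 (ba_dirac x).
Proof. by move=> E /=; rewrite /dirac_fun; case: ifP. Qed.

Lemma ba_dirac_ca x : countably_additive (ba_dirac x).
Proof.
move=> F mF tF mUF.
have := @measure_semi_sigma_additive _ _ R (\d_x) F mF tF mUF.
rewrite ba_diracE //; apply: cvg_trans; apply: near_eq_cvg; apply: nearW => n.
by apply: eq_bigr => i _; rewrite ba_diracE.
Qed.

Lemma bint_dirac x f : bm f -> ba_integral (ba_dirac x) f = f x.
Proof.
move=> bf; apply: (bint_eq (C := 1) bf) => e g e0 fg.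
rewrite mulr1 (_ : simple_integral _ g = g x) // /simple_integral fsbig_finite //.
have mg y : measurable (g @^-1` [set y]) by exact: measurable_sfunP.
rewrite (bigD1_seq (g x)) ?fset_uniq //=; last first.
  by rewrite in_fset_set // inE; exists x.
rewrite /dirac_fun asboolT // indicE mem_set // mulr1 big1 ?addr0 // => y yx.
rewrite asboolT // indicE memNset ?mulr0 //= => gxy.
by move: yx; rewrite -gxy eqxx.
Qed.

Lemma bint_simpleE mu (g : {sfun X >-> R}) : ba_integral mu g =
  \sum_(y <- fset_set (range g)) y * mu (g @^-1` [set y]).
Proof. by rewrite ba_integral_simple /simple_integral fsbig_finite. Qed.

Lemma bint_dist_le mu f1 f2 (e : R) : bm f1 -> bm f2 -> 0 <= e ->
    (forall x, `|f1 x - f2 x| <= e) ->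
  `|ba_integral mu f1 - ba_integral mu f2| <= e * ba_norm mu.
Proof.
by move=> b1 b2 e0 f12; rewrite -bintB //; apply: bint_norm_le => //; exact: bmB.
Qed.

Lemma bm_sfun (g : {sfun X >-> R}) : bm g.
Proof. by split=> //; exact: sfun_bounded. Qed.

Variable P : R.-pker X ~> X.
Local Notation A := (markov_op P).

Lemma markov_opE mu E : measurable E -> A mu E = ba_integral mu (fun x => fine (P x E)).
Proof. by move=> mE; rewrite /= /markov_fun asboolT. Qed.

Lemma bm_kernel E : measurable E -> bm (fun x => fine (P x E)).
Proof.
by move=> mE; split; [exact: measurable_fine_kernel|exists 1; exact: fine_kernel_le1].
Qed.

Lemma markov_op_lin (a : R) mu nu : A (a *: mu + nu) = a *: A mu + A nu.
Proof.
apply: ba_eqP => E mE.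
by rewrite ba_linE !markov_opE // bint_lin //; exact: bm_kernel.
Qed.

Lemma markov_op_ge0 mu : ba_ge0 mu -> ba_ge0 (A mu).
Proof.
move=> mu0 E; have [mE|nE] := pselect (measurable E); last by rewrite ba_nmeas.
by rewrite markov_opE //; apply: bint_ge0 => [||x]; [|exact: bm_kernel|exact: fine_ge0].
Qed.

Lemma markov_op_mass mu : A mu setT = mu setT.
Proof.
rewrite markov_opE // (_ : (fun=> _) = fun=> 1); last first.
  by apply/funext => x; rewrite prob_kernel.
by rewrite bint_cst mul1r.
Qed.

(** The k-step transition probability p^k(x, .), obtained from the operator so that no composition
    of kernels has to be formed. *)
Definition kpow k x : ba X R := iter k A (ba_dirac x).

Lemma iter_markov_ge0 k mu : ba_ge0 mu -> ba_ge0 (iter k A mu).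
Proof. by move=> mu0; elim: k => //= k ih; exact: markov_op_ge0. Qed.

Lemma iter_markov_mass k mu : iter k A mu setT = mu setT.
Proof. by elim: k => // k ih; rewrite iterS markov_op_mass. Qed.

Lemma iter_markov_ca k mu : countably_additive mu -> countably_additive (iter k A mu).
Proof. by move=> muca; elim: k => //= k ih; exact: markov_op_ca. Qed.

Lemma kpow_ge0 k x : ba_ge0 (kpow k x).
Proof. exact/iter_markov_ge0/ba_dirac_ge0. Qed.

Lemma kpow_mass k x : kpow k x setT = 1.
Proof. by rewrite /kpow iter_markov_mass ba_diracE // indicT. Qed.

Lemma kpow_ca k x : countably_additive (kpow k x).
Proof. exact/iter_markov_ca/ba_dirac_ca. Qed.

Lemma kpow_norm k x : ba_norm (kpow k x) = 1.
Proof. by rewrite ba_ge0_norm ?kpow_mass //; exact: kpow_ge0. Qed.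

Lemma kpow1_simple x (g : {sfun X >-> R}) : ba_integral (kpow 1 x) g =
  \sum_(y <- fset_set (range g)) y * fine (P x (g @^-1` [set y])).
Proof.
rewrite bint_simpleE; apply: eq_bigr => y _; congr (_ * _).
have mg : measurable (g @^-1` [set y]) by exact: measurable_sfunP.
by rewrite [kpow 1 x]/(A _) markov_opE // bint_dirac //; exact: bm_kernel.
Qed.

(** For a simple function both claims reduce by linearity to the definition of A on sets. They
    extend to f by uniform approximation, because p(x, .) has norm 1 and the error is therefore
    uniform in x. *)
Lemma bint_kpow1 f : bm f -> bm (fun x => ba_integral (kpow 1 x) f) /\
  forall mu, ba_integral mu (fun x => ba_integral (kpow 1 x) f) = ba_integral (A mu) f.
Proof.
move=> bf.
have bs (g : {sfun X >-> R}) : bm (fun x => ba_integral (kpow 1 x) g).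
  under eq_fun do rewrite kpow1_simple.
  apply: bm_sum => y; apply/bmZ/bm_kernel; exact: measurable_sfunP.
have Is (g : {sfun X >-> R}) mu :
    ba_integral mu (fun x => ba_integral (kpow 1 x) g) = ba_integral (A mu) g.
  under eq_fun do rewrite kpow1_simple.
  have mg y : measurable (g @^-1` [set y]) by exact: measurable_sfunP.
  rewrite bint_sum => [|y]; last exact/bmZ/bm_kernel.
  rewrite bint_simpleE; apply: eq_bigr => y _.
  by rewrite bintZ ?markov_opE //; exact: bm_kernel.
have dist (e : R) (g : {sfun X >-> R}) : 0 < e -> (forall x, `|f x - g x| <= e) ->
    forall x, `|ba_integral (kpow 1 x) f - ba_integral (kpow 1 x) g| <= e.
  move=> e0 fg x; have := bint_dist_le (kpow 1 x) bf (bm_sfun g) (ltW e0) fg.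
  by rewrite kpow_norm mulr1.
have bT : bm (fun x => ba_integral (kpow 1 x) f).
  apply: bm_uniform_limit => e e0; have [g fg] := bm_approx bf e0.
  by exists (fun x => ba_integral (kpow 1 x) g) => //; exact: dist.
split=> // mu; apply/eqP; rewrite -subr_eq0 -normr_le0; apply/ler_addgt0Pr => e e0.
rewrite add0r; pose C := ba_norm mu + ba_norm (A mu) + 1.
have C0 : 0 < C by rewrite ltr_wpDl // addr_ge0 // ba_norm_ge0.
have eC0 : 0 < e / C by rewrite divr_gt0.
have [g fg] := bm_approx bf eC0.
have d1 := bint_dist_le mu bT (bs g) (ltW eC0) (dist _ _ eC0 fg).
have d2 := bint_dist_le (A mu) bf (bm_sfun g) (ltW eC0) fg.
rewrite Is in d1; rewrite distrC in d2.
rewrite -(subrKA (ba_integral (A mu) g)) (le_trans (ler_normD _ _)) //.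
rewrite (le_trans (lerD d1 d2)) // -mulrDr mulrAC ler_pdivrMr // ler_pM2l //.
by rewrite lerDl.
Qed.

Lemma bint_kpow k f : bm f -> bm (fun x => ba_integral (kpow k x) f) /\
  forall mu, ba_integral mu (fun x => ba_integral (kpow k x) f) = ba_integral (iter k A mu) f.
Proof.
elim: k f => [|k ih] f bf.
  have -> : (fun x => ba_integral (kpow 0 x) f) = f; last by [].
  by apply/funext => x; rewrite bint_dirac.
have [b1 I1] := bint_kpow1 bf; have [bk Ik] := ih _ b1.
have eqk : (fun x => ba_integral (kpow k.+1 x) f) =
    fun x => ba_integral (kpow k x) (fun y => ba_integral (kpow 1 y) f).
  by apply/funext => x; rewrite I1.
by rewrite eqk; split=> // mu; rewrite Ik I1.
Qed.

Lemma bm_integral_kpow k f : bm f -> bm (fun x => ba_integral (kpow k x) f).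
Proof. by move/(bint_kpow k) => []. Qed.

Lemma bint_iter k mu f : bm f ->
  ba_integral (iter k A mu) f = ba_integral mu (fun x => ba_integral (kpow k x) f).
Proof. by move/(bint_kpow k) => [_ ->]. Qed.

Lemma bm_kpow k E : measurable E -> bm (fun x => kpow k x E).
Proof.
move=> mE; have := bm_integral_kpow k (bm_indic R mE).
by under eq_fun do rewrite bint_indicE //.
Qed.

Lemma iter_markovE k mu E : measurable E ->
  iter k A mu E = ba_integral mu (fun x => kpow k x E).
Proof.
move=> mE; rewrite -bint_indicE // bint_iter; last exact: bm_indic.
by under eq_fun do rewrite bint_indicE //.
Qed.

(** The Chapman-Kolmogorov equation, in its form for functions. *)
Lemma bint_kpowD j k x f : bm f ->
  ba_integral (kpow (j + k) x) f = ba_integral (kpow k x) (fun y => ba_integral (kpow j y) f).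
Proof. by move=> bf; rewrite /kpow iterD bint_iter. Qed.

Lemma kpowD j k x E : measurable E ->
  kpow (j + k) x E = ba_integral (kpow k x) (fun y => kpow j y E).
Proof. by move=> mE; rewrite /kpow iterD iter_markovE. Qed.

Lemma kpow_le1 k x E : kpow k x E <= 1.
Proof. by rewrite -(kpow_norm k x) (le_trans (ler_norm _)) // le_norm_variation. Qed.

End markov_kernels.

(** * Limits of bounded sequences along ultrafilters *)

Section ultralimits.
Context {R : realType}.

(** Compactness of [-M, M] gives a cluster point. An ultrafilter contains the preimage of each
    neighbourhood or its complement, and the complement is excluded at a cluster point. *)
Lemma ultrafilter_bounded_cvg (U : set_system nat) (u : nat -> R) (M : R) :
  UltraFilter U -> (forall n, `|u n| <= M) -> cvg (u n @[n --> U]).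
Proof.
move=> UU uM; have PU := @ultra_proper _ _ UU.
have [p [_ clp]] : `[- M, M]%classic `&` cluster (u n @[n --> U]) !=set0.
  apply: segment_compact; apply: nearW => n /=.
  by rewrite in_itv /= -ler_norml.
apply/cvg_ex; exists p => V Vp.
have [//|UV] := in_ultra_setVsetC (u @^-1` V) UU.
by have [y [/= nVy Vy]] := clp (~` V) V UV Vp.
Qed.

Lemma free_ultrafilter : exists U : set_system nat, UltraFilter U /\ \oo `<=` U.
Proof. exact: ultraFilterLemma. Qed.

End ultralimits.

(** * Positive countably additive measures and setwise limits *)

Section positive_ca.
Import HBSimple.
Context {d : measure_display} (X : measurableType d) (R : realType).
Implicit Types (mu nu : ba X R) (E F : set X).

Definition ca_measure mu (mu0 : ba_ge0 mu) (muca : countably_additive mu) :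
  set X -> \bar R := fun E => (mu E)%:E.

Section ca_measure.
Variables (mu : ba X R) (mu0 : ba_ge0 mu) (muca : countably_additive mu).
Local Notation m := (ca_measure mu0 muca).

Let m0 : m set0 = 0%E.
Proof. by rewrite /ca_measure ba_set0. Qed.

Let m_ge0 E : (0 <= m E)%E.
Proof. by rewrite lee_fin. Qed.

Let m_ca : semi_sigma_additive m.
Proof. exact: muca. Qed.

HB.instance Definition _ := isMeasure.Build _ _ _ m m0 m_ge0 m_ca.

Lemma borel_cantelli_ca (F : nat -> set X) (C : R) : (forall n, measurable (F n)) ->
  (forall n, mu (F n) <= C / 2 ^+ n) -> mu (lim_sup_set F) = 0.
Proof.
move=> mF muF; apply: EFin_inj.
apply: (@lim_sup_set_cvg0 _ _ _ m) => //.
have C0 : 0 <= C by rewrite (le_trans (mu0 (F 0%N))) // (le_trans (muF 0%N)) // expr0 divr1.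
apply: (@le_lt_trans _ _ (2 * C)%:E); last exact: ltry.
(* The geometric series used here starts at 1/2, hence the total 2 C for terms C / 2^i. *)
apply: le_trans (epsilon_trick0 xpredT (_ : 0 <= 2 * C)); last by rewrite mulr_ge0.
apply: lee_nneseries => [i _ _|i _]; first exact: m_ge0.
by rewrite lee_fin (le_trans (muF i)) // natrX exprS -mulf_div divff // mul1r.
Qed.

(** The limsup is the decreasing intersection of the tail unions, and a finite measure is continuous
    from above. *)
Lemma lim_sup_set_ge_ca (F : nat -> set X) (e : R) : (forall n, measurable (F n)) ->
  (forall n, e <= mu (\bigcup_(j in [set j | (n <= j)%N]) F j)) ->
  e <= mu (lim_sup_set F).
Proof.
move=> mF eF; pose G n := \bigcup_(j in [set j | (n <= j)%N]) F j.
have mG n : measurable (G n) by exact: bigcup_measurable.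
have : (m \o G) n @[n --> \oo] --> m (\bigcap_n G n).
  apply: nonincreasing_cvg_mu => //; first exact: ltry.
  - exact: bigcap_measurable.
  - move=> n p np; apply/subsetPset => x [j /= pj Fx].
    by exists j => //=; exact: leq_trans pj.
move=> /cvg_lim limG; rewrite -lee_fin -[leRHS]limG //.
apply: lime_ge; last by apply: nearW => n; rewrite /= lee_fin; exact: eF.
apply/cvg_ex; eexists; apply: nonincreasing_cvg_mu => //; first exact: ltry.
- exact: bigcap_measurable.
- move=> n p np; apply/subsetPset => x [j /= pj Fx].
  by exists j => //=; exact: leq_trans pj.
Qed.

End ca_measure.

Lemma ba_sumE (I : Type) (s : seq I) (mu : I -> ba X R) E :
  (\sum_(i <- s) mu i) E = \sum_(i <- s) mu i E.
Proof.
elim: s => [|i s ih]; first by rewrite !big_nil.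
by rewrite !big_cons -ih.
Qed.

Lemma ca_sum (I : Type) (s : seq I) (mu : I -> ba X R) :
  (forall i, countably_additive (mu i)) -> countably_additive (\sum_(i <- s) mu i).
Proof.
move=> muca; apply: set_mem; apply: (@rpred_sum _ (ca_pred (X := X) (R := R))).
by move=> i _; exact: mem_set.
Qed.

Lemma caZ (a : R) mu : countably_additive mu -> countably_additive (a *: mu).
Proof.
move=> muca; apply: set_mem; apply: (@rpredZ _ _ (ca_pred (X := X) (R := R))).
exact: mem_set.
Qed.

Lemma ca0 : countably_additive (0 : ba X R).
Proof. by apply: set_mem; exact: (@rpred0 _ (ca_pred (X := X) (R := R))). Qed.

Section setwise_limit.
Variables (U : set_system nat) (PU : ProperFilter U) (nu : nat -> ba X R) (mu : ba X R).
Hypothesis numu : forall E, measurable E -> nu n E @[n --> U] --> mu E.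

Lemma cvg_bint_simple (s : seq R) (E : R -> set X) : (forall y, measurable (E y)) ->
  \sum_(y <- s) y * nu n (E y) @[n --> U] --> \sum_(y <- s) y * mu (E y).
Proof.
move=> mE; elim: s => [|y s ih].
  by rewrite big_nil; under eq_fun do rewrite big_nil; exact: cvg_cst.
rewrite big_cons; under eq_fun do rewrite big_cons.
by apply: cvgD => //; apply: cvgMr; exact: numu.
Qed.

(** The common norm bound lets one simple function approximate f for all [nu n] at once; on that
    function convergence is setwise convergence on finitely many fibres. *)
Lemma cvg_bint (C : R) f : (forall n, ba_norm (nu n) <= C) -> bm f ->
  ba_integral (nu n) f @[n --> U] --> ba_integral mu f.
Proof.
move=> nuC bf; apply/cvgrPdist_le => e e0.
pose K := ba_norm mu + `|C| + 1.
have K0 : 0 < K by rewrite ltr_wpDl // addr_ge0 // ba_norm_ge0.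
have eK0 : 0 < e / K by rewrite divr_gt0.
have [g fg] := bm_approx bf eK0.
have mg y : measurable (g @^-1` [set y]) by exact: measurable_sfunP.
have /cvgrPdist_le /(_ _ eK0) := cvg_bint_simple (s := fset_set (range g)) mg.
apply: filterS => n; rewrite -!bint_simpleE => ng.
have d1 := bint_dist_le mu bf (bm_sfun g) (ltW eK0) fg.
have d2 := bint_dist_le (nu n) bf (bm_sfun g) (ltW eK0) fg.
have d3 : e / K * ba_norm (nu n) <= e / K * `|C|.
  by rewrite ler_wpM2l ?(ltW eK0) // (le_trans (nuC n)) // ler_norm.
have -> : e = e / K * ba_norm mu + e / K * `|C| + e / K.
  by rewrite -mulrDr -[X in _ = _ + X]mulr1 -mulrDr divfK // gt_eqF.
move: d1 d2 ng; rewrite !ler_norml => /andP[? ?] /andP[? ?] /andP[? ?].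
by apply/andP; split; lra.
Qed.

End setwise_limit.
End positive_ca.

(** * Cesaro averages, their invariant limits and their uniform absolute continuity *)

Section invariant_means.
Context {d : measure_display} (X : measurableType d) (R : realType).
Variable P : R.-pker X ~> X.
Implicit Types (mu nu : ba X R) (f : X -> R) (E F : set X).
Local Notation A := (markov_op P).
Local Notation kpow := (kpow P).

Lemma markov_op0 : A 0 = 0.
Proof. by apply: ba_eqP => E mE; rewrite markov_opE // bint_measure0 //; exact: bm_kernel. Qed.

Lemma markov_opD mu nu : A (mu + nu) = A mu + A nu.
Proof. by have := markov_op_lin P 1 mu nu; rewrite !scale1r. Qed.

Lemma markov_opZ (a : R) mu : A (a *: mu) = a *: A mu.
Proof. by have := markov_op_lin P a mu 0; rewrite markov_op0 !addr0. Qed.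

Lemma markov_op_sum (I : Type) (s : seq I) (mu : I -> ba X R) :
  A (\sum_(i <- s) mu i) = \sum_(i <- s) A (mu i).
Proof.
elim: s => [|i s ih]; first by rewrite !big_nil markov_op0.
by rewrite !big_cons markov_opD ih.
Qed.

Definition cesaro n x : ba X R := n.+1%:R^-1 *: \sum_(0 <= i < n.+1) kpow i x.

Lemma baZE (a : R) mu E : (a *: mu) E = a * mu E.
Proof. by []. Qed.

Lemma cesaroE n x E : cesaro n x E = n.+1%:R^-1 * \sum_(0 <= i < n.+1) kpow i x E.
Proof. by rewrite baZE ba_sumE. Qed.

Lemma cesaro_ge0 n x : ba_ge0 (cesaro n x).
Proof.
by move=> E; rewrite cesaroE mulr_ge0 // sumr_ge0 // => i _; exact: kpow_ge0.
Qed.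

Lemma cesaro_mass n x : cesaro n x setT = 1.
Proof.
rewrite cesaroE; under eq_bigr do rewrite kpow_mass.
by rewrite sumr_const_nat subn0 mulVf.
Qed.

Lemma cesaro_norm n x : ba_norm (cesaro n x) = 1.
Proof. by rewrite ba_ge0_norm ?cesaro_mass //; exact: cesaro_ge0. Qed.

Lemma cesaro_ca n x : countably_additive (cesaro n x).
Proof. by apply: caZ; apply: ca_sum => i; exact: kpow_ca. Qed.

(** The difference telescopes to its last and first terms, both in [0, 1]. *)
Lemma cesaro_almost_invariant n x E : `|A (cesaro n x) E - cesaro n x E| <= n.+1%:R^-1.
Proof.
rewrite markov_opZ markov_op_sum cesaroE baZE ba_sumE -mulrBr -sumrB.
rewrite (eq_bigr (fun i => kpow i.+1 x E - kpow i x E)) // telescope_sumr //.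
rewrite normrM ger0_norm // ler_piMr //.
have := kpow_le1 P n.+1 x E; have := kpow_le1 P 0 x E.
have := kpow_ge0 P n.+1 x E; have := kpow_ge0 P 0 x E.
by move=> *; rewrite ler_norml; apply/andP; split; lra.
Qed.

(** The starting point may vary with n because the invariance defect is at most 1/(n+1) at every
    point. Additivity, positivity and mass pass to the limit along a free ultrafilter; invariance
    does so because integrals of p(., E) converge. *)
Lemma cesaro_limit (x : nat -> X) : exists U mu,
  [/\ ProperFilter U, \oo `<=` U, Delta_ba P mu
    & forall E, measurable E -> cesaro n (x n) E @[n --> U] --> mu E].
Proof.
have [U [UU ooU]] := free_ultrafilter; have PU := @ultra_proper _ _ UU.
pose nu n := cesaro n (x n).
pose m E := lim (nu n E @[n --> U]).
have nu1 n E : `|nu n E| <= 1 by rewrite -(cesaro_norm n (x n)) le_norm_variation.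
have cvm E : nu n E @[n --> U] --> m E.
  by apply: (@ultrafilter_bounded_cvg _ U (fun n => nu n E) 1).
have limE E (l : R) : nu n E @[n --> U] --> l -> m E = l.
  by move=> /cvg_lim; apply.
have mba : m \in ba_pred (X := X) (R := R).
  rewrite inE; split=> [E nE|E F mE mF EF|].
  - by apply: limE; under eq_fun do rewrite ba_nmeas //; exact: cvg_cst.
  - apply: limE; under eq_fun do rewrite ba_add //.
    by apply: cvgD; exact: cvm.
  - exists 1 => E _; rewrite ler_norml; apply/andP; split.
      by apply: limr_ge; [exact: cvm|apply: nearW => n; have := nu1 n E; rewrite ler_norml => /andP[]].
    by apply: limr_le; [exact: cvm|apply: nearW => n; have := nu1 n E; rewrite ler_norml => /andP[]].
pose mu : ba X R := Ba mba.
exists U, mu; split=> //.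
have mu0 : ba_ge0 mu.
  by move=> E; apply: limr_ge; [exact: cvm|apply: nearW => n; exact: cesaro_ge0].
split; first split=> //.
  rewrite -[LHS]/(ba_norm mu) ba_ge0_norm //.
  by apply: limE; under eq_fun do rewrite cesaro_mass; exact: cvg_cst.
apply: ba_eqP => E mE; rewrite markov_opE //.
apply/esym/limE.
have /(_ 1 _ _ (bm_kernel P mE)) := @cvg_bint _ _ _ U PU nu mu (fun E _ => cvm E).
move=> /(_ (fun n => eq_ind_r (fun y => y <= 1) (lexx 1) (cesaro_norm n (x n)))).
have dif0 : (nu n E - A (nu n) E) @[n --> U] --> (0 : R).
  apply/cvgrPdist_le => e e0; apply: ooU.
  apply: filterS (near_infty_natSinv_lt (PosNum e0)) => n /ltW; apply: le_trans.
  by rewrite sub0r opprB cesaro_almost_invariant.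
move=> /(cvgD dif0); rewrite add0r; apply: cvg_trans; apply: near_eq_cvg.
apply: nearW => n.
rewrite -[LHS]/(nu n E - A (nu n) E + ba_integral (nu n) (fun x => fine (P x E))).
by rewrite -markov_opE // subrK.
Qed.

Lemma cesaro_equicontinuous (e : R) : Delta_ba P `<=` @countably_additive d X R -> 0 < e ->
  exists n (lam : ba X R) (dl : R), [/\ ba_ge0 lam, countably_additive lam, 0 < dl
    & forall x E, measurable E -> lam E < dl -> cesaro n x E <= e].
Proof.
move=> Dca e0; apply: contrapT => no.
have bad n (lam : ba X R) : ba_ge0 lam -> countably_additive lam ->
    exists xE : X * set X, [/\ measurable xE.2, lam xE.2 < (2 ^+ n)^-1
      & e < cesaro n xE.1 xE.2].
  move=> lam0 lamca; apply: contrapT => nobad; apply: no.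
  exists n, lam, (2 ^+ n)^-1; split=> // x E mE lamE.
  rewrite leNgt; apply/negP => eE; apply: nobad.
  by exists (x, E).
(* The zero measure is admissible in [bad], so X has a point; it is the default value in the choice
   below. *)
have [[x0 _] _] : exists xE : X * set X, True.
  have [||xE _] := bad 0%N 0; last by exists xE.
  - by move=> E.
  - exact: ca0.
have /choice[c cP] : forall p : nat * ba X R, exists xE : X * set X,
    ba_ge0 p.2 -> countably_additive p.2 -> [/\ measurable xE.2, p.2 xE.2 < (2 ^+ p.1)^-1
      & e < cesaro p.1 xE.1 xE.2].
  move=> [n lam]; have [lam0|?] := pselect (ba_ge0 lam); last by exists (x0, set0).
  have [lamca|?] := pselect (countably_additive lam); last by exists (x0, set0).
  by have [xE ?] := bad n lam lam0 lamca; exists xE.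
(* [sg n] is the sum of all earlier averages. Used as the measure at stage n, it makes the n-th set
   small for each of them simultaneously. *)
pose sg := fix sg n : ba X R :=
  if n is m.+1 then sg m + cesaro m (c (m, sg m)).1 else 0.
pose x n := (c (n, sg n)).1; pose F n := (c (n, sg n)).2.
pose nu n := cesaro n (x n).
have sgE n : sg n = \sum_(0 <= i < n) nu i.
  by elim: n => [|n ih]; [rewrite big_geq|rewrite big_nat_recr //= -ih].
have sg0 n : ba_ge0 (sg n).
  by move=> E; rewrite sgE ba_sumE sumr_ge0 // => i _; exact: cesaro_ge0.
have sgca n : countably_additive (sg n).
  by rewrite sgE; apply: ca_sum => i; exact: cesaro_ca.
have FP n : [/\ measurable (F n), sg n (F n) < (2 ^+ n)^-1 & e < nu n (F n)].
  exact: (cP (n, sg n) (sg0 n) (sgca n)).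
have mF n : measurable (F n) by have [] := FP n.
have mG n : measurable (\bigcup_(j in [set j | (n <= j)%N]) F j) by exact: bigcup_measurable.
have mL : measurable (lim_sup_set F) by exact: bigcap_measurable.
(* For n <= i the right side is at least 1 and the bound is trivial; for n > i the smallness of
   [sg n (F n)] gives even 1/2^n. For fixed i this is summable in n. *)
have nuF i n : nu i (F n) <= 2 ^+ i / 2 ^+ n.
  have [ni|lt_in] := leqP n i.
    rewrite (@le_trans _ _ 1) //.
      by rewrite (le_trans (ler_norm _)) // -(cesaro_norm i (x i)) le_norm_variation.
    by rewrite ler_pdivlMr ?exprn_gt0 // mul1r ler_eXn2l ?ltr1n.
  have [_ /ltW sgF _] := FP n; rewrite (@le_trans _ _ (2 ^+ n)^-1) //; last first.
    by rewrite ler_peMl ?invr_ge0 ?exprn_ge0 // exprn_ege1 // ler1n.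
  apply: le_trans sgF; rewrite sgE ba_sumE (bigD1_seq i) ?iota_uniq //=; last first.
    by rewrite mem_index_iota.
  by rewrite lerDl sumr_ge0 // => j _; exact: cesaro_ge0.
have [U [mu [PU ooU Dmu numu]]] := cesaro_limit x.
have muca := Dca _ Dmu.
have [[muS mu1] _] := Dmu.
have mu0 : ba_ge0 mu.
  move=> E; have [mE|nE] := pselect (measurable E); first exact: muS.
  by rewrite ba_nmeas.
have : e <= mu (lim_sup_set F).
  apply: (lim_sup_set_ge_ca mu0 muca) => // n.
  rewrite -(cvg_lim _ (numu _ (mG n))) //.
  apply: limr_ge; first by apply/cvg_ex; eexists; exact: numu.
  (* From j = n on, the tail union contains [F j], to which the j-th average gives mass above e. *)
  apply: ooU; exists n => // j /= nj; have [_ _ /ltW eF] := FP j.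
  apply: le_trans eF _; apply: ba_subset => //; first exact: cesaro_ge0.
  by move=> y Fy; exists j.
(* By Borel-Cantelli every single average gives the limsup mass 0, hence so does the limit. *)
apply/negP; rewrite -ltNge (_ : mu _ = 0) //.
rewrite -(cvg_lim _ (numu _ mL)) //; apply: cvg_lim => //.
rewrite (_ : (fun n => _) = cst 0); first exact: cvg_cst.
apply/funext => n.
have -> // := borel_cantelli_ca (cesaro_ge0 n (x n)) (@cesaro_ca n (x n)) mF (nuF n).
Qed.

End invariant_means.

(** * From averages to one power: the Doeblin condition *)

Section doeblin.
Context {d : measure_display} (X : measurableType d) (R : realType).
Variable P : R.-pker X ~> X.
Implicit Types (mu nu lam : ba X R) (f : X -> R) (E F : set X).
Local Notation A := (markov_op P).
Local Notation kpow := (kpow P).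

Definition dominates lam (dl : R) k (e : R) :=
  forall x E, measurable E -> lam E < dl -> kpow k x E <= e.

Lemma le_bint_kpow k x f E (a b : R) : 0 <= a -> 0 <= b -> bm f -> measurable E ->
  (forall y, f y <= a + b * \1_E y) -> ba_integral (kpow k x) f <= a + b * kpow k x E.
Proof.
move=> a0 b0 bf mE fE; have bE := bm_indic R mE.
have := bint_le (kpow_ge0 P k x) bf (bmD (bm_cst _ a) (bmZ b bE)) fE.
by rewrite bintD ?bintZ ?bint_cst ?bint_indicE ?kpow_mass ?mulr1 //; [exact: bm_cst|exact: bmZ].
Qed.

(** Write p^(n+1) as p^i followed by p^(n+1-i), for each i <= n. The set H where some remaining
    p^(n+1-i)(., E) may be large has small [lam]-measure, so averaging p^i(x, H) over i brings in
    the Cesaro bound. *)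
Lemma exists_dominating (e : R) : Delta_ba P `<=` @countably_additive d X R -> 0 < e ->
  exists k lam dl, [/\ (0 < k)%N, ba_ge0 lam, 0 < dl & dominates lam dl k e].
Proof.
move=> Dca e0; have e20 : 0 < e / 2 by rewrite divr_gt0.
have [n [lam [dl [lam0 _ dl0 ces]]]] := cesaro_equicontinuous Dca e20.
(* Chosen so that [lam' E] is the [lam]-integral of the function [g] below; Markov's inequality then
   gives [lam H < dl]. *)
pose lam' := \sum_(0 <= i < n.+1) iter (n.+1 - i) A lam.
exists n.+1, lam', (e / 2 * dl); split=> //; last 1 first.
- move=> x E mE lamE.
  pose g y := \sum_(0 <= i < n.+1) kpow (n.+1 - i) y E.
  have bg : bm g by apply: bm_sum => i; exact: bm_kpow.
  have g0 y : 0 <= g y by apply: sumr_ge0 => i _; exact: kpow_ge0.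
  have Ig : ba_integral lam g = lam' E.
    rewrite /g bint_sum => [|i]; last exact: bm_kpow.
    by rewrite ba_sumE; apply: eq_bigr => i _; rewrite iter_markovE.
  pose H := [set y | e / 2 <= g y].
  have mH : measurable H by exact: bm_ge.
  have lamH : lam H < dl.
    by rewrite -(ltr_pM2l e20) (le_lt_trans _ lamE) // -Ig markov_ineq.
  (* Off H, each summand of [g] is below e/2; on H the trivial bound 1 is used. *)
  have kE i : (0 <= i < n.+1)%N -> kpow n.+1 x E <= e / 2 + kpow i x H.
    move=> /andP[_ ltin]; rewrite -[kpow i x H]mul1r -(subnK (ltnW ltin)) kpowD //.
    apply: le_bint_kpow => //; [exact: ltW|exact: bm_kpow|move=> y].
    rewrite mul1r indicE; case: (boolP (y \in H)) => [_|yH].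
      by rewrite (le_trans (kpow_le1 _ _ _ _)) // lerDr ltW.
    rewrite addr0; have : g y < e / 2 by rewrite ltNge; apply: contra yH => ?; rewrite inE.
    move=> /ltW; apply: le_trans; rewrite /g (bigD1_seq i) ?iota_uniq ?mem_index_iota //=.
    by rewrite lerDl sumr_ge0 // => j _; exact: kpow_ge0.
  have := @ler_sum_nat R 0 n.+1 (fun=> kpow n.+1 x E) (fun i => e / 2 + kpow i x H) kE.
  rewrite sumr_const_nat big_split sumr_const_nat subn0 => h2.
  rewrite -[leLHS]mulr_natl -[(e / 2) *+ _]mulr_natl in h2.
  have := ces x H mH lamH; rewrite cesaroE ler_pdivrMl // => h1.
  have := le_trans h2 (lerD (lexx _) h1).
  by rewrite -mulrDr ler_pM2l // -splitr.
- by move=> E; rewrite ba_sumE sumr_ge0 // => i _; exact: iter_markov_ge0.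
- by rewrite mulr_gt0.
Qed.

(** * Finite measurable partitions, coded by the index of the cell, and conditional means *)

Definition partition_map m (kap : X -> nat) :=
  (forall x, (kap x < m)%N) /\ forall j, measurable (kap @^-1` [set j]).

Lemma partition_mapE m kap (u : nat -> R) : partition_map m kap ->
  u \o kap = fun x => \sum_(j < m) u j * \1_(kap @^-1` [set val j]) x.
Proof.
move=> [km _]; apply/funext => x /=.
rewrite (bigD1 (Ordinal (km x))) //= indicE mem_set // mulr1 big1 ?addr0 // => j jx.
rewrite indicE memNset ?mulr0 //= => xj; move: jx; apply/negP; rewrite negbK.
by apply/eqP/val_inj.
Qed.

Lemma bm_partition_map m kap (u : nat -> R) : partition_map m kap -> bm (u \o kap).
Proof.
move=> kapP; rewrite (partition_mapE _ kapP); apply: bm_sum => j.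
by apply/bmZ/bm_indic; exact: kapP.2.
Qed.

(** The conditional probability of E given cell j; on a null cell, division by zero makes it 0. *)
Definition cell_mean lam (kap : X -> nat) E j : R :=
  lam (E `&` kap @^-1` [set j]) / lam (kap @^-1` [set j]).

(** The function 1_E - E[1_E | partition]. *)
Definition deviation lam kap E x : R := \1_E x - cell_mean lam kap E (kap x).

Section deviation.
Variables (lam : ba X R) (lam0 : ba_ge0 lam) (m : nat) (kap : X -> nat).
Hypothesis kapP : partition_map m kap.
Variables (E : set X) (mE : measurable E).

Let mk j : measurable (kap @^-1` [set j]) := kapP.2 j.

Lemma cell_mean01 j : 0 <= cell_mean lam kap E j <= 1.
Proof.
rewrite divr_ge0 //=; have [l0|] := eqVneq (lam (kap @^-1` [set j])) 0.
  by rewrite /cell_mean l0 invr0 mulr0.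
move=> l0; rewrite ler_pdivrMr ?mul1r; last by rewrite lt_neqAle eq_sym l0 lam0.
by apply: ba_subset => //; exact: measurableI.
Qed.

Lemma bm_deviation : bm (deviation lam kap E).
Proof. by apply: bmB; [exact: bm_indic|exact: bm_partition_map kapP]. Qed.

Lemma deviation_le1 x : `|deviation lam kap E x| <= 1.
Proof.
have /andP[c0 c1] := cell_mean01 (kap x).
by rewrite /deviation indicE ler_norml; case: (_ \in _) => /=; apply/andP; split; lra.
Qed.

(** On each cell u is constant and the deviation has integral 0. A null cell causes no trouble: its
    intersection with E is null too. *)
Lemma deviation_orthogonal (u : nat -> R) :
  ba_integral lam (fun x => u (kap x) * deviation lam kap E x) = 0.
Proof.
have -> : (fun x => u (kap x) * deviation lam kap E x) = fun x => \sum_(j < m)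
    u j * (\1_(E `&` kap @^-1` [set val j]) x -
           cell_mean lam kap E j * \1_(kap @^-1` [set val j]) x).
  apply/funext => x.
  have := partition_mapE (fun j => u j * deviation lam kap E x) kapP.
  have := partition_mapE (fun j => u j * (\1_E x - cell_mean lam kap E j)) kapP.
  move=> /(congr1 (@^~ x)) /= + _; rewrite /deviation => ->.
  apply: eq_bigr => j _; rewrite -mulrA mulrBl; congr (_ * (_ - _)).
  by rewrite !indicE in_setI -natrM mulnb.
have bI j : bm (\1_(E `&` kap @^-1` [set j]) : X -> R) by apply/bm_indic/measurableI.
have bP j : bm (\1_(kap @^-1` [set j]) : X -> R) by exact: bm_indic.
have bC j : bm (fun x => cell_mean lam kap E j * \1_(kap @^-1` [set j]) x) by exact: bmZ.
rewrite bint_sum => [|j]; last by apply/bmZ/bmB.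
rewrite big1 // => j _; rewrite bintZ; last exact: bmB.
rewrite bintB // bintZ // !bint_indicE //; last exact: measurableI.
rewrite /cell_mean; have [l0|l0] := eqVneq (lam (kap @^-1` [set val j])) 0; last first.
  by rewrite divfK // subrr mulr0.
suff -> : lam (E `&` kap @^-1` [set val j]) = 0 by rewrite !mul0r subrr mulr0.
by apply/eqP; rewrite eq_le lam0 andbT -l0; apply: ba_subset => //; exact: measurableI.
Qed.

Lemma bint_deviation mu :
  ba_integral mu (deviation lam kap E) =
  mu E - \sum_(j < m) cell_mean lam kap E j * mu (kap @^-1` [set val j]).
Proof.
rewrite bintB ?bint_indicE //; [|exact: bm_indic|exact: bm_partition_map kapP].
congr (_ - _); have := partition_mapE (cell_mean lam kap E) kapP; rewrite /comp => ->.
have bP j : bm (\1_(kap @^-1` [set j]) : X -> R) by exact: bm_indic.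
rewrite bint_sum => [|j]; last exact: bmZ.
by apply: eq_bigr => j _; rewrite bintZ // bint_indicE.
Qed.

(** Doubling the index frees its lowest bit, which records membership in F: halving recovers the old
    cell, and parity the side of F. *)
Definition refine (kp : X -> nat) F x : nat := ((kp x).*2 + (x \in F))%N.

Lemma refineE (kp : X -> nat) F x : (refine kp F x)./2 = kp x /\ odd (refine kp F x) = (x \in F).
Proof.
rewrite /refine addnC; split; last by rewrite oddD odd_double addbF oddb.
by rewrite half_bit_double.
Qed.

Lemma refine_partition : partition_map m.*2 (refine kap E).
Proof.
split=> [x|j].
  have [r2 r1] := refineE kap E x; have := kapP.1 x; rewrite /refine.
  by case: (x \in E) => /=; lia.
have -> : refine kap E @^-1` [set j] =
    kap @^-1` [set j./2] `&` (if odd j then E else ~` E).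
  apply/seteqP; split => x /=.
    move=> <-; have [-> ->] := refineE kap E x; split=> //.
    by case: (boolP (x \in E)) => [xE|]; [exact: set_mem|rewrite notin_setE].
  move=> [kj jE]; rewrite /refine kj.
  have -> : (x \in E) = odd j.
    by move: jE; case: (odd j) => xE; [exact: mem_set|exact: memNset].
  by rewrite addnC odd_double_half.
by apply: measurableI => //; case: ifP => // _; exact: measurableC.
Qed.

End deviation.

End doeblin.

(** * Greedy refinement of partitions, and the oscillation of an iterated kernel *)

Section greedy.
Context {d : measure_display} (X : measurableType d) (R : realType).
Variable P : R.-pker X ~> X.
Implicit Types (mu nu lam : ba X R) (f : X -> R) (E F : set X).
Local Notation kpow := (kpow P).

Section deviation_sequence.
Variables (lam : ba X R) (lam0 : ba_ge0 lam).
Variables (m : nat -> nat) (kap : nat -> X -> nat) (E : nat -> set X).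
Hypothesis mE : forall n, measurable (E n).
Hypothesis kapP : forall n, partition_map (m n) (kap n).
Hypothesis kapS : forall n, kap n.+1 = refine (kap n) (E n).

Local Notation f n := (deviation lam (kap n) (E n)).
Let F (a : nat -> R) n x : R := \sum_(0 <= i < n) a i * f i x.

Let bf n : bm (f n).
Proof. exact: bm_deviation. Qed.

Let bF a n : bm (F a n).
Proof. by apply: bm_sum => i; exact: bmZ. Qed.

Let F_recr a n x : F a n.+1 x = F a n x + a n * f n x.
Proof. by rewrite /F big_nat_recr. Qed.

(** The n-th partition remembers all earlier sets, so the partial sum is constant on its cells; this
    makes the n-th deviation orthogonal to it. *)
Let F_factor a n : exists u : nat -> R, forall x, F a n x = u (kap n x).
Proof.
elim: n => [|n [u uE]]; first by exists (fun=> 0) => x; rewrite /F big_geq.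
exists (fun j => u j./2 + a n * ((odd j)%:R - cell_mean lam (kap n) (E n) j./2)) => x.
have [r1 r2] := refineE (kap n) (E n) x.
by rewrite F_recr kapS r1 r2 uE /deviation indicE.
Qed.

(** Pythagoras: the cross term vanishes by orthogonality, and each new square is at most 1
    pointwise. *)
Let F_sq a n : (forall i, `|a i| <= 1) ->
  ba_integral lam (fun x => F a n x * F a n x) <= n%:R * lam setT.
Proof.
move=> a1; elim: n => [|n ih].
  rewrite mul0r (_ : (fun x => _) = fun=> 0); first by rewrite bint_cst mul0r.
  by apply/funext => x; rewrite /F big_geq // mul0r.
have [u uE] := F_factor a n.
have -> : (fun x => F a n.+1 x * F a n.+1 x) = fun x =>
    F a n x * F a n x + (2 * a n * (u (kap n x) * f n x) + a n * f n x * (a n * f n x)).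
  by apply/funext => x; rewrite F_recr uE; ring.
have bff : bm (fun x => a n * f n x * (a n * f n x)) by apply: bmM; exact: bmZ.
have buf : bm (fun x => u (kap n x) * f n x).
  by apply: bmM => //; exact: bm_partition_map (kapP n).
have bFF : bm (fun x => F a n x * F a n x) by exact: bmM.
rewrite bintD //; last by apply: bmD => //; exact: bmZ.
rewrite bintD //; last exact: bmZ.
rewrite bintZ // (deviation_orthogonal lam0 (kapP n) (mE n)) mulr0 add0r.
rewrite -natr1 mulrDl mul1r lerD // -[leRHS]mul1r -bint_cst.
apply: bint_le => //; first exact: bm_cst.
move=> x; rewrite -expr2 -real_normK ?num_real // exprn_ile1 //.
by rewrite normrM mulr_ile1 // (deviation_le1 lam0 (kapP n) (mE n)).
Qed.

Let F_le a n x : (forall i, `|a i| <= 1) -> `|F a n x| <= n%:R.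
Proof.
move=> a1; rewrite (le_trans (ler_norm_sum _ _ _)) //.
rewrite -[leRHS]mulr1 -[n in leRHS]subn0 mulr_natl -sumr_const_nat; apply: ler_sum => i _.
by rewrite normrM mulr_ile1 // (deviation_le1 lam0 (kapP i) (mE i)).
Qed.

(* The deviations are orthogonal in L^2(lam), so a signed sum of N of them is of order
   sqrt N off a set of small measure, while the trivial bound is N. *)
Lemma deviation_sequence_average k (dl e : R) N x : dominates P lam dl k e ->
    lam setT < (e * e * dl) * N%:R -> 0 < e ->
  \sum_(0 <= n < N) `|ba_integral (kpow k x) (f n)| <= 2 * e * N%:R.
Proof.
move=> dom Nbig e0.
(* The signs depend on x; they turn the sum of absolute values into one integral. *)
pose a n := Num.sg (ba_integral (kpow k x) (f n)).
have a1 n : `|a n| <= 1 by rewrite normr_sg lern1 leq_b1.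
have -> : \sum_(0 <= n < N) `|ba_integral (kpow k x) (f n)| = ba_integral (kpow k x) (F a N).
  rewrite /F bint_sum => [|n]; last exact: bmZ.
  by apply: eq_bigr => n _; rewrite bintZ // normrEsg.
have N0 : 0 < N%:R :> R.
  rewrite lt0r ler0n andbT; apply/eqP => N0; move: Nbig; rewrite N0 mulr0.
  by rewrite ltNge lam0.
pose c : R := e * N%:R; have c0 : 0 < c by rewrite mulr_gt0.
have bFF : bm (fun x => F a N x * F a N x) by exact: bmM.
pose H := [set y | c * c <= F a N y * F a N y].
have mH : measurable H by exact: bm_ge.
have lamH : lam H < dl.
  have FF0 y : 0 <= F a N y * F a N y by rewrite -expr2 sqr_ge0.
  have := le_trans (markov_ineq (c * c) lam0 bFF FF0) (F_sq N a1).
  (* Markov's inequality for the square gives c^2 lam(H) <= N lam(X), and the size of N makes the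
     right side smaller than c^2 dl. *)
  rewrite -/H => h; have := le_lt_trans h (_ : _ < N%:R * (e * e * dl * N%:R)).
  rewrite ltr_pM2l // => /(_ Nbig).
  rewrite (_ : _ * (_ * _ * _ * _) = c * c * dl); last by rewrite /c; ring.
  by rewrite ltr_pM2l // mulr_gt0.
have := @le_bint_kpow _ _ _ P k x (F a N) H c N%:R (ltW c0) (ltW N0) (bF a N) mH.
have FH y : F a N y <= c + N%:R * \1_H y.
  rewrite indicE; case: (boolP (y \in H)) => [_|yH].
    by rewrite mulr1 (le_trans (ler_norm _)) // (le_trans (F_le _ _ a1)) // lerDr ltW.
  rewrite mulr0 addr0 leNgt; apply: contra yH => cF; rewrite inE /H /=.
  by apply: ler_pM => //; exact: ltW.
move=> /(_ FH) h; rewrite (le_trans h) //.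
have := dom x H mH lamH => kH.
have -> : 2 * e * N%:R = c + N%:R * e by rewrite /c; ring.
by rewrite lerD // ler_wpM2l // ltW.
Qed.

End deviation_sequence.

Lemma partition_map1 : partition_map 1 (fun=> 0%N : nat) (X := X).
Proof.
split=> // j; have [->|j0] := eqVneq j 0%N.
  by rewrite (_ : _ @^-1` _ = setT) //; apply/seteqP; split.
rewrite (_ : _ @^-1` _ = set0) // -subset0 => x /= j0'.
by move: j0; rewrite -j0'.
Qed.

(** Otherwise every partition has a bad set by which it can be refined. After N stages the N
    integrals add up to more than 2 e N mu(X), against the pointwise bound 2 e N on the sum of the
    integrands. *)
Lemma small_mean_deviation lam (lam0 : ba_ge0 lam) k (dl e : R) mu :
    ba_ge0 mu -> 0 < dl -> 0 < e -> dominates P lam dl k e ->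
  exists m kap, partition_map m kap /\ forall E, measurable E ->
    ba_integral mu (fun x => `|ba_integral (kpow k x) (deviation lam kap E)|) <=
    2 * e * mu setT.
Proof.
move=> mu0 dl0 e0 dom; apply: contrapT => no.
have /choice[c cP] : forall p : nat * (X -> nat), exists E, partition_map p.1 p.2 ->
    measurable E /\ 2 * e * mu setT <
    ba_integral mu (fun x => `|ba_integral (kpow k x) (deviation lam p.2 E)|).
  move=> [m kap]; have [kapP|?] := pselect (partition_map m kap); last by exists set0.
  apply: contrapT => nobad; apply: no; exists m, kap; split=> // E mE.
  by rewrite leNgt; apply/negP => bad; apply: nobad; exists E.
pose st := fix st n := if n is n'.+1 then ((st n').1.*2, refine (st n').2 (c (st n')))
                       else (1%N, fun=> 0%N).
have stP n : partition_map (st n).1 (st n).2.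
  elim: n => [|n ih] /=; first exact: partition_map1.
  by apply: refine_partition => //; have [] := cP _ ih.
have mE n : measurable (c (st n)) by have [] := cP _ (stP n).
have [N Nbig] : exists N, lam setT < (e * e * dl) * N%:R.
  have D0 : 0 < e * e * dl by rewrite !mulr_gt0.
  exists (Num.bound (lam setT / (e * e * dl))); rewrite mulrC -ltr_pdivrMr //.
  by apply: archi_boundP; rewrite divr_ge0 // ltW.
(* At least one term is needed for the strict inequality between the sums. *)
have N0 : (0 < N)%N.
  by rewrite lt0n; apply/eqP => N0; move: Nbig; rewrite N0 mulr0 ltNge lam0.
have avg x := deviation_sequence_average lam0 mE stP (fun=> erefl) x dom Nbig e0.
have bT n : bm (fun x => `|ba_integral (kpow k x) (deviation lam (st n).2 (c (st n)))|).
  by apply/bm_norm/bm_integral_kpow/(bm_deviation _ (stP n)).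
have := bint_le mu0 (bm_sum (index_iota 0 N) bT) (bm_cst _ _) avg.
rewrite bint_cst bint_sum //; apply/negP; rewrite -ltNge.
have -> : 2 * e * N%:R * mu setT = \sum_(0 <= i < N) (2 * e * mu setT).
  by rewrite sumr_const_nat subn0 -[RHS]mulr_natr mulrAC.
apply: ltr_sum_nat => // n _.
by have [] := cP _ (stP n).
Qed.

(** Two Doeblin conditions are combined. The one for [lam2] makes p^k2 of every deviation small in
    mean under [lam], hence below e off a set of [lam]-measure less than [dl]. By the condition for
    [lam], k1 further steps give this set mass at most e from every x. The coefficients depend on E
    but not on x. *)
Lemma uniform_deviation (e : R) : Delta_ba P `<=` @countably_additive d X R -> 0 < e ->
  exists k m kap, [/\ (0 < k)%N, partition_map m kap
    & forall E, measurable E -> exists c : nat -> R, (forall j, 0 <= c j <= 1) /\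
      forall x, `|kpow k x E - \sum_(j < m) c j * kpow k x (kap @^-1` [set val j])| <= 2 * e].
Proof.
move=> Dca e0; have [k1 [lam [dl [k10 lam0 dl0 dom]]]] := exists_dominating Dca e0.
(* Makes the mean bound 2 e' lam(X) smaller than e dl, as Markov's inequality at level e requires;
   the added 1 covers lam(X) = 0. *)
pose e' := e * dl / (2 * (lam setT + 1)).
have lam10 : 0 < lam setT + 1 by rewrite ltr_wpDl.
have e'0 : 0 < e' by rewrite divr_gt0 ?mulr_gt0.
have [k2 [lam2 [dl2 [k20 lam20 dl20 dom2]]]] := exists_dominating Dca e'0.
have [m [kap [kapP dev]]] := small_mean_deviation lam20 lam0 dl20 e'0 dom2.
exists (k2 + k1)%N, m, kap; split=> // [|E mE]; first by rewrite addn_gt0 k20.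
exists (cell_mean lam2 kap E); split; first exact: cell_mean01 kapP _ mE.
move=> x; rewrite -(bint_deviation _ kapP mE).
have bd := bm_deviation lam2 kapP mE.
rewrite bint_kpowD //; set g := fun y => _.
have bg : bm g by exact: bm_integral_kpow.
have g1 y : `|g y| <= 1.
  have := bint_norm_le (kpow k2 y) bd ler01 (deviation_le1 lam20 kapP mE).
  by rewrite kpow_norm mulr1.
rewrite (le_trans (le_bint_norm (kpow_ge0 P k1 x) bg)) //.
have bng := bm_norm bg.
pose H := [set y | e <= `|g y|]; have mH : measurable H by exact: bm_ge.
have lamH : lam H < dl.
  have := le_trans (markov_ineq e lam0 bng (fun=> normr_ge0 _)) (dev E mE).
  rewrite -/H => h; rewrite -(ltr_pM2l e0) (le_lt_trans h) //.
  rewrite /e'.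
  have -> : 2 * (e * dl / (2 * (lam setT + 1))) * lam setT = e * dl * (lam setT / (lam setT + 1)).
    by field; rewrite gt_eqF.
  by rewrite gtr_pMr ?mulr_gt0 // ltr_pdivrMr // mul1r ltrDl.
have := @le_bint_kpow _ _ _ P k1 x (fun y => `|g y|) H e 1 (ltW e0) ler01 bng mH.
have gH y : `|g y| <= e + 1 * \1_H y.
  rewrite indicE mul1r; case: (boolP (y \in H)) => [_|yH].
    by rewrite (le_trans (g1 y)) // lerDr ltW.
  by rewrite addr0 leNgt; apply: contra yH => /ltW eg; rewrite inE.
move=> /(_ gH) /le_trans; apply; rewrite mul1r mulr_natl mulr2n lerD //.
exact: dom.
Qed.

(** By induction, the partition is intersected with the level sets of the next function at mesh e;
    [M] bounds the number of levels. *)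
Lemma oscillation_partition n (h : nat -> X -> R) (e : R) : 0 < e ->
    (forall j, bm (h j)) -> (forall j x, 0 <= h j x <= 1) ->
  exists m kap, partition_map m kap /\ forall x y, kap x = kap y ->
    forall j, (j < n)%N -> `|h j x - h j y| <= e.
Proof.
move=> e0 bh h01; elim: n => [|n [m [kap [kapP kaph]]]].
  by exists 1%N, (fun=> 0%N); split=> //; exact: partition_map1.
pose t x := Num.trunc (h n x / e).
have tP x : (t x)%:R <= h n x / e < (t x).+1%:R.
  by apply: truncn_itv; rewrite divr_ge0 ?(ltW e0) //; have /andP[] := h01 n x.
pose M := (Num.trunc e^-1).+1.
have tM x : (t x < M)%N.
  have /andP[lo _] := tP x; have /andP[_ h1] := h01 n x.
  have /andP[_ hi] : (Num.trunc e^-1)%:R <= e^-1 < M%:R.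
    by apply: truncn_itv; rewrite invr_ge0 ltW.
  rewrite -(ltr_nat R) (le_lt_trans lo) // (le_lt_trans _ hi) //.
  by rewrite ler_piMl // invr_ge0 ltW.
have mt i : measurable (t @^-1` [set i]).
  rewrite (_ : _ @^-1` _ = [set x | i%:R * e <= h n x] `\` [set x | i.+1%:R * e <= h n x]).
    by apply: measurableD; exact: bm_ge.
  apply/seteqP; split=> x /=.
    move=> <-; have /andP[lo hi] := tP x; rewrite -ler_pdivlMr //; split=> //.
    by rewrite -ler_pdivlMr //; apply/negP; rewrite -ltNge.
  rewrite -!ler_pdivlMr // => -[lo /negP]; rewrite -ltNge => hi.
  by apply: truncn_def; rewrite lo.
(* The pair of level and old cell is coded in base m, and decoded by quotient and remainder. *)
exists (M * m)%N, (fun x => t x * m + kap x)%N; have [km mk] := kapP.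
have decode x : ((t x * m + kap x) %/ m = t x)%N /\ ((t x * m + kap x) %% m = kap x)%N.
  have m0 : (0 < m)%N by rewrite (leq_ltn_trans _ (km x)).
  by rewrite divnMDl // modnMDl divn_small // modn_small // addn0.
split; first split=> [x|j].
- rewrite (@leq_trans ((t x).+1 * m)) //; first by rewrite mulSn addnC ltn_add2r.
  by rewrite leq_mul2r tM orbT.
- rewrite (_ : _ @^-1` _ = t @^-1` [set j %/ m]%N `&` kap @^-1` [set j %% m]%N).
    exact: measurableI.
  apply/seteqP; split=> x /=; first by move=> <-; have [-> ->] := decode x.
  by move=> [-> ->]; rewrite -divn_eq.
move=> x y xy j; rewrite ltnS leq_eqVlt => /predU1P[->|jn]; last first.
  apply: kaph => //; have [_ <-] := decode x; have [_ <-] := decode y.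
  by rewrite xy.
have txy : t x = t y.
  by have [<- _] := decode x; have [<- _] := decode y; rewrite xy.
have /andP[lo hi] := tP x; have /andP[lo' hi'] := tP y.
move: hi hi' lo lo'; rewrite txy ler_pdivlMr // ltr_pdivrMr // ler_pdivlMr // ltr_pdivrMr //.
by rewrite -natr1 mulrDl mul1r ler_norml => *; apply/andP; split; lra.
Qed.

(** Up to a small error each p^k(., E) is a combination, with coefficients in [0, 1], of the same
    finitely many functions. A partition controlling these therefore controls all E at once. *)
Lemma uniform_oscillation (e : R) : Delta_ba P `<=` @countably_additive d X R -> 0 < e ->
  exists k m kap, [/\ (0 < k)%N, partition_map m kap
    & forall x y, kap x = kap y -> forall E, measurable E ->
      `|kpow k x E - kpow k y E| <= e].
Proof.
(* The approximation errors at x and y are 2 e/5 each, and the combinations differ by at most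
   e/5. *)
move=> Dca e0; have e50 : 0 < e / 5 by rewrite divr_gt0.
have [k [m [kap [k0 kapP dev]]]] := uniform_deviation Dca e50.
have em0 : 0 < e / 5 / m.+1%:R by rewrite divr_gt0.
have [| |m' [kap' [kapP' osc]]] :=
  oscillation_partition m (h := fun j x => kpow k x (kap @^-1` [set j])) em0.
- by move=> j; apply: bm_kpow; exact: kapP.2.
- by move=> j x; rewrite kpow_le1 andbT; exact: kpow_ge0.
exists k, m', kap'; split=> // x y xy E mE; have [c [c01 cE]] := dev E mE.
have cxy : `|\sum_(j < m) c j * kpow k x (kap @^-1` [set val j]) -
    \sum_(j < m) c j * kpow k y (kap @^-1` [set val j])| <= e / 5.
  rewrite -sumrB (le_trans (ler_norm_sum _ _ _)) //.
  rewrite (@le_trans _ _ (\sum_(j < m) e / 5 / m.+1%:R)) //.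
    apply: ler_sum => j _; rewrite -mulrBr normrM; have /andP[c0 c1] := c01 j.
    by rewrite ger0_norm // -[leRHS]mul1r ler_pM //; exact: (osc x y xy j (ltn_ord j)).
  rewrite sumr_const card_ord -[leLHS]mulr_natr mulrAC ler_pdivrMr //.
  by rewrite ler_pM2l // ler_nat.
have := cE x; have := cE y; move: cxy.
rewrite !ler_norml => /andP[? ?] /andP[? ?] /andP[? ?].
by apply/andP; split; lra.
Qed.

End greedy.

(** * Compactness of bounded sets of linear combinations *)

Section finite_rank.
Context {R : realType} {V : normedModType R}.

Lemma compact_bounded_combinations (w : nat -> V) (M : R) n :
  compact [set \sum_(i < n) c i *: w i | c in [set c : nat -> R | forall i, `|c i| <= M]].
Proof.
elim: n => [|n ih].
  have [M0|M0] := leP 0 M.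
    rewrite (_ : _ @` _ = [set 0]); first exact: compact_set1.
    apply/seteqP; split=> [_ [c _ <-]|_ ->]; first by rewrite big_ord0.
    by exists (fun=> 0); rewrite ?big_ord0 // => i; rewrite normr0.
  rewrite (_ : _ @` _ = set0); first exact: compact0.
  rewrite -subset0 => y [c cM _]; have := cM 0%N; rewrite leNgt => /negP; apply.
  exact: lt_le_trans (normr_ge0 _).
set S := (X in compact X) in ih.
have cM : compact `[- M, M]%classic by exact: segment_compact.
rewrite (_ : _ @` _ = (fun p : V * R => p.1 + p.2 *: w n) @` (S `*` `[- M, M])).
  apply: continuous_compact; last exact: compact_setX.
  apply: continuous_subspaceT => p.
  by apply: cvgD; [exact: cvg_fst|apply: cvgZl; exact: cvg_snd].
apply/seteqP; split=> [_ [c cM' <-]|_ [[_ a] [[c cM' <-]] /= aM <-]].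
  exists (\sum_(i < n) c i *: w i, c n); last by rewrite big_ord_recr.
  by split; [exists c|rewrite /= in_itv /= -ler_norml].
(* The coefficient bound is required at every index, so all indices from n on receive the bounded
   value a. *)
exists (fun i => if (i < n)%N then c i else a) => [i|].
  by case: ifP => // _; move: aM; rewrite in_itv /= -ler_norml.
rewrite big_ord_recr /= ltnn; congr (_ + _).
by apply: eq_bigr => i _; rewrite ltn_ord.
Qed.

End finite_rank.

(** * Finite rank operators on countably additive measures *)

Section ca_finite_rank.
Context {d : measure_display} (X : measurableType d) (R : realType).
Implicit Types (mu nu : ba X R) (E : set X).
Variables (m : nat) (Q : nat -> set X) (w : nat -> ca X R).

Definition cell_op (mu : ca X R) : ca X R := \sum_(i < m) mu (Q i) *: w i.

Lemma cell_op_linear : linear cell_op.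
Proof.
move=> a mu nu; rewrite /cell_op scaler_sumr -big_split /=; apply: eq_bigr => i _.
by rewrite scalerA -scalerDl.
Qed.

HB.instance Definition _ := GRing.isLinear.Build R (ca X R) (ca X R) _ cell_op
  cell_op_linear.

(** Since |mu(Q i)| is at most the norm of mu, a bounded set is mapped into combinations of the
    [w i] with bounded coefficients. *)
Lemma cell_op_compact : compact_operator cell_op.
Proof.
move=> B /pinfty_ex_gt0[M _ BM].
have cK := @compact_bounded_combinations R (ca X R) w M m.
apply: (@precompact_subset _ _ _ _ (_ : precompact _)); last first.
  rewrite precompact_closed; first exact: cK.
  by apply: compact_closed cK; exact: norm_hausdorff.
move=> _ [mu Bmu <-]; exists (fun i => mu (Q i)) => // i.
exact: le_trans (le_norm_variation mu (Q i)) (BM mu Bmu).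
Qed.

Lemma ca_sumE (I : Type) (s : seq I) (mu : I -> ca X R) E :
  (\sum_(i <- s) mu i) E = \sum_(i <- s) mu i E.
Proof.
elim: s => [|i s ih]; first by rewrite !big_nil.
by rewrite !big_cons -ih.
Qed.

Lemma cell_opE (mu : ca X R) E : cell_op mu E = \sum_(i < m) mu (Q i) * w i E.
Proof. by rewrite /cell_op ca_sumE. Qed.

(** In a disjoint family, the sets of nonnegative and of negative mass are united separately; each
    union contributes at most b. *)
Lemma ba_norm_le2 mu (b : R) : (forall E, measurable E -> `|mu E| <= b) ->
  ba_norm mu <= 2 * b.
Proof.
move=> mub; apply: Defs.variation_le => n F mF tF.
pose S (p : pred nat) := \big[setU/set0]_(i <- index_iota 0 n | p i) F i.
have mS p : measurable (S p) by exact: bigsetU_measurable.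
have muS p : mu (S p) = \sum_(0 <= i < n | p i) mu (F i).
  rewrite ba_bigU //; first exact: iota_uniq.
  by apply: sub_trivIset tF => i /=; rewrite mem_index_iota.
rewrite -(big_mkord xpredT (fun i => `|mu (F i)|)) (bigID (fun i => 0 <= mu (F i))) /=.
rewrite mulr_natl mulr2n lerD //.
  rewrite (eq_bigr (fun i => mu (F i))) => [|i Fi]; last by rewrite ger0_norm.
  by rewrite -(muS (fun i => 0 <= mu (F i))) (le_trans (ler_norm _)) ?mub.
rewrite (eq_bigr (fun i => - mu (F i))) => [|i Fi]; last by rewrite ltr0_norm // ltNge.
rewrite sumrN -(muS (fun i => ~~ (0 <= mu (F i)))).
by rewrite (le_trans (ler_norm _)) // normrN mub.
Qed.

End ca_finite_rank.

(** * Approximation of a power of the operator and conclusion *)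

Section quasicompactness.
Context {d : measure_display} (X : measurableType d) (R : realType).
Variable P : R.-pker X ~> X.

Lemma iter_markov_ca_val k (mu : ca X R) :
  ca_val (iter k (markov_ca P) mu) = iter k (markov_op P) (ca_val mu).
Proof. by elim: k => //= k ->. Qed.

Definition kpow_ca_elt k x : ca X R := Ca (mem_set (@kpow_ca _ X R P k x)).

(** On a set E both operators are integrals against mu: of p^k(x, E), and of its value at the
    representative of the cell of x. The integrands differ by at most e. *)
Lemma iter_markov_cell_op_dist k m kap (p : nat -> X) (e : R) (mu : ca X R) :
    0 <= e -> partition_map m kap ->
    (forall x E, measurable E -> `|kpow P k x E - kpow P k (p (kap x)) E| <= e) ->
  `|iter k (markov_ca P) mu - cell_op m (fun i => kap @^-1` [set i])
      (fun i => kpow_ca_elt k (p i)) mu| <= 2 * (e * `|mu|).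
Proof.
move=> e0 kapP osc; apply: ba_norm_le2 => E mE; set op := cell_op _ _ _ _.
have -> : (iter k (markov_ca P) mu - op) E = iter k (markov_op P) mu E - op E.
  by rewrite -iter_markov_ca_val.
rewrite /op cell_opE iter_markovE //.
pose u i := kpow P k (p i) E.
have <- : ba_integral mu (u \o kap) = \sum_(i < m) mu (kap @^-1` [set val i]) * u i.
  have bP j : bm (\1_(kap @^-1` [set j]) : X -> R) by apply: bm_indic; exact: kapP.2.
  rewrite (partition_mapE u kapP) bint_sum => [|j]; last exact: bmZ.
  by apply: eq_bigr => j _; rewrite bintZ // bint_indicE ?(mulrC (u j)) //; exact: kapP.2.
apply: bint_dist_le => //; [exact: bm_kpow|exact: bm_partition_map kapP|].
by move=> x; exact: osc.
Qed.

End quasicompactness.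

Theorem corollary4p3 (R : realType) (d : measure_display) (X : measurableType d)
    (X_infinite : infinite_set [set: X])
    (X_singletons : forall x : X, measurable [set x])
    (P : R.-pker X ~> X) :
  Delta_ba P `<=` @countably_additive d X R ->
  quasicompact (markov_ca P).
Proof.
(* Oscillation 1/4 yields operator distance at most 2/4, the 2 coming from the passage from sets to
   total variation. *)
move=> Dca; have e0 : 0 < 4^-1 :> R by rewrite invr_gt0.
have [k [m [kap [k0 kapP osc]]]] := uniform_oscillation Dca e0.
have [x0 _] : exists x : X, True.
  apply: contrapT => noX; apply: X_infinite; rewrite (_ : setT = set0) //.
  by rewrite -subset0 => x _; apply: noX; exists x.
(* A representative of each cell; [x0] is the default for empty cells. *)
pose p i := xget x0 (kap @^-1` [set i]).
have pP x : kap (p (kap x)) = kap x.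
  by apply: (@xgetPex _ x0 (kap @^-1` [set kap x])); exists x.
exists (cell_op m (fun i => kap @^-1` [set i]) (fun i => kpow_ca_elt P k (p i))); split.
  exact: cell_op_compact.
exists k => //; apply: (@le_lt_trans _ _ (2^-1)%:E); last first.
  by rewrite lte_fin invf_lt1 ?ltr1n.
apply: ge_ereal_sup => _ [mu /= mu1 <-]; rewrite lee_fin.
apply: le_trans (iter_markov_cell_op_dist mu (ltW e0) kapP _) _.
  by move=> x E mE; apply: osc.
by rewrite mulrA; move: mu1; set t := `|mu|; lra.
Qed.
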